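(* Let $(V,\triangleright,[\cdot,\cdot])$ be a graded post-Lie algebra over a field $\mathbb{K}$ of characteristic zero, $V=\bigoplus_{n\ge 1}V_n$ with every $V_n$ finite-dimensional and both operations homogeneous of degree $0$. Let $\mathfrak g=(V,[\cdot,\cdot])$, and let $\mathcal{H}^{\ast}=(\mathcal{U}(\mathfrak{g})^{\ast},\sqcup\!\sqcup,\Delta_{\ast})$ and $\mathcal{H}_T^{\ast}=(\mathcal{U}(\mathfrak{g})^{\ast},\sqcup\!\sqcup,\Delta_{\odot})$ be the graded duals of the Hopf algebras $\mathcal H=(\mathcal{U}(\mathfrak{g}),\ast,\Delta_{\sqcup\!\sqcup})$ and $\mathcal H_T=(\mathcal{U}(\mathfrak{g}),\cdot,\Delta_{\sqcup\!\sqcup})$. Let $\rho_{\triangleright}:\mathcal{H}_T^{\ast}\to\mathcal{H}^{\ast}\otimes\mathcal{H}_T^{\ast}$ be the linear map dual to $\triangleright$, that is, $\langle A\triangleright B,x\rangle=\langle A\otimes B,\rho_{\triangleright}(x)\rangle$ for all $A,B\in\mathcal{U}(\mathfrak g)$ and $x\in\mathcal{U}(\mathfrak g)^{\ast}$. Then $\rho_{\triangleright}$ is a coaction of $\mathcal{H}^{\ast}$ on $\mathcal{H}_T^{\ast}$, and the bialgebras $\mathcal{H}_T^{\ast}$ and $\mathcal{H}^{\ast}$ are in cointeraction via $\rho_{\triangleright}$.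
   Context: Post-Lie algebra: a vector space $V$ with a Lie bracket $[\cdot,\cdot]$ and a bilinear product $\triangleright$ such that for all $x,y,z\in V$: $[x,y]\triangleright z=x\triangleright(y\triangleright z)-(x\triangleright y)\triangleright z-y\triangleright(x\triangleright z)+(y\triangleright x)\triangleright z$ and $x\triangleright[y,z]=[x\triangleright y,z]+[y,x\triangleright z]$. Guin--Oudom construction: $\mathcal{U}(\mathfrak{g})$ is the universal enveloping algebra of $\mathfrak g$, with product $\cdot$ (written by juxtaposition) and its usual cocommutative coproduct $\Delta_{\sqcup\!\sqcup}$ (for which elements of $\mathfrak g$ are primitive), $\Delta_{\sqcup\!\sqcup}(A)=A_{(1)}\otimes A_{(2)}$, and counit $\epsilon$. The product $\triangleright$ extends uniquely to $\mathcal{U}(\mathfrak{g})$ by $1\triangleright A=A$, $A\triangleright 1=\epsilon(A)1$, $xA\triangleright y=x\triangleright(A\triangleright y)-(x\triangleright A)\triangleright y$, $A\triangleright BC=(A_{(1)}\triangleright B)(A_{(2)}\triangleright C)$ for $x,y\in\mathfrak g$, $A,B,C\in\mathcal{U}(\mathfrak g)$. Set $A\ast B=A_{(1)}\cdot(A_{(2)}\triangleright B)$. It is known that $\ast$ is associative and unital, that $\mathcal H=(\mathcal{U}(\mathfrak g),\ast,\Delta_{\sqcup\!\sqcup})$ is a Hopf algebra, and that $A\triangleright(B\triangleright C)=(A\ast B)\triangleright C$. $\mathcal{U}(\mathfrak g)^{\ast}$ is the graded dual; $\sqcup\!\sqcup$, $\Delta_{\ast}$, $\Delta_{\odot}$ are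 dual to $\Delta_{\sqcup\!\sqcup}$, $\ast$, $\cdot$ respectively. Cointeraction: bialgebras $(\mathcal A,\odot_{\mathcal A},\Delta_{\mathcal A},\epsilon_{\mathcal A})$ and $(\mathcal B,\odot_{\mathcal B},\Delta_{\mathcal B},\epsilon_{\mathcal B})$ are in cointeraction via $\rho:\mathcal A\to\mathcal B\otimes\mathcal A$ if $\rho$ is a (left) coaction of $\mathcal B$ on $\mathcal A$, i.e. $(\Delta_{\mathcal B}\otimes\mathrm{id})\rho=(\mathrm{id}\otimes\rho)\rho$ and $(\epsilon_{\mathcal B}\otimes\mathrm{id})\rho=\mathrm{id}$, and (1) $\rho(1_{\mathcal A})=1_{\mathcal B}\otimes 1_{\mathcal A}$; (2) $\rho(x\odot_{\mathcal A}y)=\rho(x)(\odot_{\mathcal B}\otimes\odot_{\mathcal A})\rho(y)$ (componentwise product); (3) $(\mathrm{id}\otimes\epsilon_{\mathcal A})\rho=1_{\mathcal B}\epsilon_{\mathcal A}$; (4) $(\mathrm{id}\otimes\Delta_{\mathcal A})\rho=m^{1,3}_{\mathcal B}(\rho\otimes\rho)\Delta_{\mathcal A}$, where $m^{1,3}_{\mathcal B}(a\otimes b\otimes c\otimes d)=(a\odot_{\mathcal B}c)\otimes b\otimes d$. Here $\mathcal A=\mathcal H_T^{\ast}$ and $\mathcal B=\mathcal H^{\ast}$. *)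

(* Defs.v *)
From HB Require Import structures.
From mathcomp Require Import all_boot all_order all_algebra generic_quotient.
From mathcomp Require Import sesquilinear.
From mathcomp Require Import boolp classical_sets functions.

Set Implicit Arguments.
Unset Strict Implicit.
Unset Printing Implicit Defensive.

Import GRing.Theory.
Local Open Scope ring_scope.
Local Open Scope quotient_scope.

(* Tensor product of two vector spaces, by generators and relations: formal   *)
(* expressions modulo the smallest congruence which makes the quotient a      *)
(* vector space and the map (v, w) |-> v ⊗ w bilinear.                        *)

Inductive tensor_term (K V W : Type) : Type :=
| TZero
| TAdd of tensor_term K V W & tensor_term K V W
| TScale of K & tensor_term K V W
| TPure of V & W.
Arguments TZero {K V W}.
Arguments TPure {K V W}.

Inductive tensor_rel (K : fieldType) (V W : lmodType K) :
    tensor_term K V W -> tensor_term K V W -> Prop :=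
| tr_refl t : tensor_rel t t
| tr_sym s t : tensor_rel s t -> tensor_rel t s
| tr_trans s t u : tensor_rel s t -> tensor_rel t u -> tensor_rel s u
| tr_addl s s' t : tensor_rel s s' -> tensor_rel (TAdd s t) (TAdd s' t)
| tr_addr s t t' : tensor_rel t t' -> tensor_rel (TAdd s t) (TAdd s t')
| tr_scale a t t' : tensor_rel t t' -> tensor_rel (TScale a t) (TScale a t')
| tr_addA s t u : tensor_rel (TAdd s (TAdd t u)) (TAdd (TAdd s t) u)
| tr_addC s t : tensor_rel (TAdd s t) (TAdd t s)
| tr_add0 t : tensor_rel (TAdd TZero t) t
| tr_addN t : tensor_rel (TAdd (TScale (-1) t) t) TZero
| tr_scaleA a b t : tensor_rel (TScale a (TScale b t)) (TScale (a * b) t)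
| tr_scale1 t : tensor_rel (TScale 1 t) t
| tr_scaleDr a s t :
    tensor_rel (TScale a (TAdd s t)) (TAdd (TScale a s) (TScale a t))
| tr_scaleDl a b t :
    tensor_rel (TScale (a + b) t) (TAdd (TScale a t) (TScale b t))
| tr_pureDl v v' w :
    tensor_rel (TPure (v + v') w) (TAdd (TPure v w) (TPure v' w))
| tr_pureDr v w w' :
    tensor_rel (TPure v (w + w')) (TAdd (TPure v w) (TPure v w'))
| tr_pureZl a v w : tensor_rel (TPure (a *: v) w) (TScale a (TPure v w))
| tr_pureZr a v w : tensor_rel (TPure v (a *: w)) (TScale a (TPure v w)).

HB.instance Definition _ (K V W : Type) := gen_eqMixin (tensor_term K V W).
HB.instance Definition _ (K V W : Type) := gen_choiceMixin (tensor_term K V W).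

Section Tensor.
Variables (K : fieldType) (V W : lmodType K).
Local Notation term := (tensor_term K V W).

Definition tensor_relb (s t : term) : bool := `[< tensor_rel s t >].

Lemma tensor_relb_refl : reflexive tensor_relb.
Proof. by move=> t; apply/asboolP; apply: tr_refl. Qed.
Lemma tensor_relb_sym : symmetric tensor_relb.
Proof. by move=> s t; apply/asboolP/asboolP; apply: tr_sym. Qed.
Lemma tensor_relb_trans : transitive tensor_relb.
Proof.
by move=> t s u /asboolP st /asboolP tu; apply/asboolP; apply: tr_trans st tu.
Qed.

Canonical tensor_equiv :=
  EquivRel tensor_relb tensor_relb_refl tensor_relb_sym tensor_relb_trans.

Definition tensor := {eq_quot tensor_equiv}.
HB.instance Definition _ := Choice.on tensor.

Definition tpi (t : term) : tensor := \pi_tensor t.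

Lemma tpi_eq s t : tensor_rel s t -> tpi s = tpi t.
Proof. by move=> st; apply/eqmodP; apply/asboolP. Qed.

Lemma tpi_repr (t : tensor) : tpi (repr t) = t.
Proof. exact: reprK. Qed.

Lemma tpi_rel (t : term) : tensor_rel (repr (tpi t)) t.
Proof. by apply/asboolP/(@eqmodP _ tensor_equiv); rewrite -[LHS]/(tpi _) tpi_repr. Qed.

Definition tens_add (s t : tensor) := tpi (TAdd (repr s) (repr t)).
Definition tens_scale (a : K) (t : tensor) := tpi (TScale a (repr t)).
Definition tpure (v : V) (w : W) := tpi (TPure v w).

Lemma tens_addE s t : tens_add (tpi s) (tpi t) = tpi (TAdd s t).
Proof.
apply: tpi_eq; apply: tr_trans (tr_addl _ (tpi_rel _)) _.
exact: tr_addr (tpi_rel _).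
Qed.

Lemma tens_scaleE a t : tens_scale a (tpi t) = tpi (TScale a t).
Proof. by apply: tpi_eq; apply: tr_scale (tpi_rel _). Qed.

Let tensP (t : tensor) : exists s, t = tpi s.
Proof. by exists (repr t); rewrite tpi_repr. Qed.

Let tens_addA : associative tens_add.
Proof.
move=> s t u; have [s' ->] := tensP s; have [t' ->] := tensP t.
have [u' ->] := tensP u; rewrite !tens_addE; exact/tpi_eq/tr_addA.
Qed.
Let tens_addC : commutative tens_add.
Proof.
move=> s t; have [s' ->] := tensP s; have [t' ->] := tensP t.
rewrite !tens_addE; exact/tpi_eq/tr_addC.
Qed.
Let tens_add0 : left_id (tpi TZero) tens_add.
Proof.
move=> t; have [t' ->] := tensP t; rewrite tens_addE; exact/tpi_eq/tr_add0.
Qed.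
Let tens_addN : left_inverse (tpi TZero) (tens_scale (-1)) tens_add.
Proof.
move=> t; have [t' ->] := tensP t; rewrite tens_scaleE tens_addE.
exact/tpi_eq/tr_addN.
Qed.

HB.instance Definition _ :=
  GRing.isZmodule.Build tensor tens_addA tens_addC tens_add0 tens_addN.

Let tens_scaleA a b t :
  tens_scale a (tens_scale b t) = tens_scale (a * b) t.
Proof.
have [t' ->] := tensP t; rewrite !tens_scaleE; exact/tpi_eq/tr_scaleA.
Qed.
Let tens_scale1 : left_id 1 tens_scale.
Proof.
move=> t; have [t' ->] := tensP t; rewrite !tens_scaleE; exact/tpi_eq/tr_scale1.
Qed.
Let tens_scaleDr : right_distributive tens_scale +%R.
Proof.
move=> a s t; have [s' ->] := tensP s; have [t' ->] := tensP t.
rewrite [tpi s' + tpi t'](tens_addE s' t') !tens_scaleE [RHS]tens_addE.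
exact/tpi_eq/tr_scaleDr.
Qed.
Let tens_scaleDl t : {morph tens_scale^~ t : a b / a + b}.
Proof.
move=> a b; have [t' ->] := tensP t.
rewrite /= !tens_scaleE ![RHS]tens_addE; exact/tpi_eq/tr_scaleDl.
Qed.

HB.instance Definition _ := GRing.Zmodule_isLmodule.Build K tensor
  tens_scaleA tens_scale1 tens_scaleDr tens_scaleDl.

Lemma tpi0 : tpi TZero = 0. Proof. by []. Qed.
Lemma tpiD s t : tpi (TAdd s t) = tpi s + tpi t.
Proof. exact/esym/tens_addE. Qed.
Lemma tpiZ a t : tpi (TScale a t) = a *: tpi t.
Proof. exact/esym/tens_scaleE. Qed.

Lemma tpureDl v v' w : tpure (v + v') w = tpure v w + tpure v' w.
Proof. by rewrite -tpiD; apply/tpi_eq/tr_pureDl. Qed.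
Lemma tpureDr v w w' : tpure v (w + w') = tpure v w + tpure v w'.
Proof. by rewrite -tpiD; apply/tpi_eq/tr_pureDr. Qed.
Lemma tpureZl a v w : tpure (a *: v) w = a *: tpure v w.
Proof. by rewrite -tpiZ; apply/tpi_eq/tr_pureZl. Qed.
Lemma tpureZr a v w : tpure v (a *: w) = a *: tpure v w.
Proof. by rewrite -tpiZ; apply/tpi_eq/tr_pureZr. Qed.

Lemma tensor_ind (P : tensor -> Prop) :
  P 0 -> (forall s t, P s -> P t -> P (s + t)) ->
  (forall a t, P t -> P (a *: t)) -> (forall v w, P (tpure v w)) ->
  forall t, P t.
Proof.
move=> P0 PD PZ Pp t; have [s ->] := tensP t; elim: s => //.
- by move=> s Ps u Pu; rewrite tpiD; apply: PD.
- by move=> a s Ps; rewrite tpiZ; apply: PZ.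
Qed.

Section Lift.
Variable L : lmodType K.

Definition bilin (b : V -> W -> L) : Prop :=
  (forall w, linear (b^~ w)) /\ (forall v, linear (b v)).

Fixpoint tensor_eval (b : V -> W -> L) (t : term) : L :=
  match t with
  | TZero => 0
  | TAdd s u => tensor_eval b s + tensor_eval b u
  | TScale a s => a *: tensor_eval b s
  | TPure v w => b v w
  end.

(* The linear map on the tensor product induced by b.  It is defined for any  *)
(* function b, but only meaningful when b is bilinear: otherwise the value    *)
(* depends on the chosen representative.                                      *)
Definition tlift (b : V -> W -> L) (t : tensor) : L := tensor_eval b (repr t).

Variable b : V -> W -> L.
Hypothesis bP : bilin b.

Lemma tensor_eval_rel s t : tensor_rel s t -> tensor_eval b s = tensor_eval b t.
Proof.
have [bl br] := bP.
have blD w : {morph b^~ w : x y / x + y}.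
  by move=> x y; have := bl w 1 x y; rewrite !scale1r.
have brD v : {morph b v : x y / x + y}.
  by move=> x y; have := br v 1 x y; rewrite !scale1r.
have bl0 w : b 0 w = 0 by apply: (addrI (b 0 w)); rewrite -blD !addr0.
have br0 v : b v 0 = 0 by apply: (addrI (b v 0)); rewrite -brD !addr0.
elim=> //=; try by move=> *; congruence.
- by move=> *; rewrite addrA.
- by move=> *; rewrite addrC.
- by move=> *; rewrite add0r.
- by move=> *; rewrite scaleN1r addNr.
- by move=> *; rewrite scalerA.
- by move=> *; rewrite scale1r.
- by move=> *; rewrite scalerDr.
- by move=> *; rewrite scalerDl.
- by move=> a v w; have := bl w a v 0; rewrite /= !addr0 bl0 addr0.
- by move=> a v w; have := br v a w 0; rewrite /= !addr0 br0 addr0.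
Qed.

Lemma tlift_tpi t : tlift b (tpi t) = tensor_eval b t.
Proof. exact/tensor_eval_rel/tpi_rel. Qed.

Lemma tlift_pure v w : tlift b (tpure v w) = b v w.
Proof. exact: tlift_tpi. Qed.

Lemma tlift_linear : linear (tlift b).
Proof.
move=> a s t; have [s' ->] := tensP s; have [t' ->] := tensP t.
by rewrite -tpiZ -tpiD !tlift_tpi.
Qed.

Lemma tlift0 : tlift b 0 = 0. Proof. by rewrite -tpi0 tlift_tpi. Qed.
Lemma tliftD s t : tlift b (s + t) = tlift b s + tlift b t.
Proof. by have := tlift_linear 1 s t; rewrite !scale1r. Qed.
Lemma tliftZ a t : tlift b (a *: t) = a *: tlift b t.
Proof. by have := tlift_linear a t 0; rewrite !addr0 tlift0 addr0. Qed.

Lemma tlift_unique (f : tensor -> L) : linear f ->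
  (forall v w, f (tpure v w) = b v w) -> f =1 tlift b.
Proof.
move=> fL fb.
have f0 : f 0 = 0.
  by apply: (addrI (f 0)); have := fL 1 0 0; rewrite !scale1r !addr0 => <-.
elim/tensor_ind => [|s t fs ft|a t ft|v w].
- by rewrite f0 tlift0.
- by have := fL 1 s t; rewrite !scale1r fs ft tliftD.
- by have := fL a t 0; rewrite !addr0 ft f0 addr0 tliftZ.
- by rewrite fb tlift_pure.
Qed.
End Lift.
End Tensor.

Arguments tensor {K} (V W)%_type_scope.
Notation "V ⊗ W" := (tensor V W) (at level 40, left associativity) : type_scope.
Notation "v ⊗ w" := (tpure v w) (at level 40, left associativity) : ring_scope.

Lemma bilin_pure (K : fieldType) (V W : lmodType K) : bilin (@tpure K V W).
Proof.
by split=> [w|v] a x y; rewrite ?tpureDl ?tpureDr ?tpureZl ?tpureZr.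
Qed.

Section TensorMaps.
Variables (K : fieldType) (X Y Z X' Y' : lmodType K).

Definition tmap (f : X -> X') (g : Y -> Y') : X ⊗ Y -> X' ⊗ Y' :=
  tlift (fun x y => f x ⊗ g y).

Definition tassoc : (X ⊗ Y) ⊗ Z -> X ⊗ (Y ⊗ Z) :=
  tlift (fun s z => tlift (fun x y => x ⊗ (y ⊗ z)) s).
End TensorMaps.

(* The universal enveloping algebra of (V, br), by generators and relations:  *)
(* formal expressions modulo the smallest congruence which makes the quotient *)
(* an associative unital algebra, UGen linear, and xy - yx = br x y on V.     *)

Inductive uea_term (K V : Type) : Type :=
| UZero
| UOne
| UAdd of uea_term K V & uea_term K V
| UMul of uea_term K V & uea_term K V
| UScale of K & uea_term K V
| UGen of V.
Arguments UZero {K V}.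
Arguments UOne {K V}.
Arguments UGen {K V}.

Inductive uea_rel (K : fieldType) (V : lmodType K) (br : V -> V -> V) :
    uea_term K V -> uea_term K V -> Prop :=
| ur_refl t : uea_rel br t t
| ur_sym s t : uea_rel br s t -> uea_rel br t s
| ur_trans s t u : uea_rel br s t -> uea_rel br t u -> uea_rel br s u
| ur_addl s s' t : uea_rel br s s' -> uea_rel br (UAdd s t) (UAdd s' t)
| ur_addr s t t' : uea_rel br t t' -> uea_rel br (UAdd s t) (UAdd s t')
| ur_mull s s' t : uea_rel br s s' -> uea_rel br (UMul s t) (UMul s' t)
| ur_mulr s t t' : uea_rel br t t' -> uea_rel br (UMul s t) (UMul s t')
| ur_scale a t t' : uea_rel br t t' -> uea_rel br (UScale a t) (UScale a t')
| ur_addA s t u : uea_rel br (UAdd s (UAdd t u)) (UAdd (UAdd s t) u)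
| ur_addC s t : uea_rel br (UAdd s t) (UAdd t s)
| ur_add0 t : uea_rel br (UAdd UZero t) t
| ur_addN t : uea_rel br (UAdd (UScale (-1) t) t) UZero
| ur_mulA s t u : uea_rel br (UMul s (UMul t u)) (UMul (UMul s t) u)
| ur_mul1l t : uea_rel br (UMul UOne t) t
| ur_mul1r t : uea_rel br (UMul t UOne) t
| ur_mulDl s t u :
    uea_rel br (UMul (UAdd s t) u) (UAdd (UMul s u) (UMul t u))
| ur_mulDr s t u :
    uea_rel br (UMul s (UAdd t u)) (UAdd (UMul s t) (UMul s u))
| ur_scaleA a b t : uea_rel br (UScale a (UScale b t)) (UScale (a * b) t)
| ur_scale1 t : uea_rel br (UScale 1 t) t
| ur_scaleDr a s t :
    uea_rel br (UScale a (UAdd s t)) (UAdd (UScale a s) (UScale a t))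
| ur_scaleDl a b t :
    uea_rel br (UScale (a + b) t) (UAdd (UScale a t) (UScale b t))
| ur_scaleMl a s t : uea_rel br (UScale a (UMul s t)) (UMul (UScale a s) t)
| ur_scaleMr a s t : uea_rel br (UScale a (UMul s t)) (UMul s (UScale a t))
| ur_genD x y : uea_rel br (UGen (x + y)) (UAdd (UGen x) (UGen y))
| ur_genZ a x : uea_rel br (UGen (a *: x)) (UScale a (UGen x))
| ur_lie x y : uea_rel br (UMul (UGen x) (UGen y))
                          (UAdd (UMul (UGen y) (UGen x)) (UGen (br x y))).

HB.instance Definition _ (K V : Type) := gen_eqMixin (uea_term K V).
HB.instance Definition _ (K V : Type) := gen_choiceMixin (uea_term K V).

Section UEA.
Variables (K : fieldType) (V : lmodType K) (br : V -> V -> V).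
Local Notation term := (uea_term K V).

Definition uea_relb (s t : term) : bool := `[< uea_rel br s t >].

Lemma uea_relb_refl : reflexive uea_relb.
Proof. by move=> t; apply/asboolP; apply: ur_refl. Qed.
Lemma uea_relb_sym : symmetric uea_relb.
Proof. by move=> s t; apply/asboolP/asboolP; apply: ur_sym. Qed.
Lemma uea_relb_trans : transitive uea_relb.
Proof.
by move=> t s u /asboolP st /asboolP tu; apply/asboolP; apply: ur_trans st tu.
Qed.

Canonical uea_equiv :=
  EquivRel uea_relb uea_relb_refl uea_relb_sym uea_relb_trans.

Definition uea := {eq_quot uea_equiv}.
HB.instance Definition _ := Choice.on uea.

Definition upi (t : term) : uea := \pi_uea t.

Lemma upi_eq s t : uea_rel br s t -> upi s = upi t.
Proof. by move=> st; apply/eqmodP; apply/asboolP. Qed.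

Lemma upi_repr (t : uea) : upi (repr t) = t.
Proof. exact: reprK. Qed.

Lemma upi_rel (t : term) : uea_rel br (repr (upi t)) t.
Proof. by apply/asboolP/(@eqmodP _ uea_equiv); rewrite -[LHS]/(upi _) upi_repr. Qed.

Definition uea_add (s t : uea) := upi (UAdd (repr s) (repr t)).
Definition uea_mul (s t : uea) := upi (UMul (repr s) (repr t)).
Definition uea_scale (a : K) (t : uea) := upi (UScale a (repr t)).
Definition uin (x : V) : uea := upi (UGen x).

Lemma uea_addE s t : uea_add (upi s) (upi t) = upi (UAdd s t).
Proof.
apply: upi_eq; apply: ur_trans (ur_addl _ (upi_rel _)) _.
exact: ur_addr (upi_rel _).
Qed.
Lemma uea_mulE s t : uea_mul (upi s) (upi t) = upi (UMul s t).
Proof.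
apply: upi_eq; apply: ur_trans (ur_mull _ (upi_rel _)) _.
exact: ur_mulr (upi_rel _).
Qed.
Lemma uea_scaleE a t : uea_scale a (upi t) = upi (UScale a t).
Proof. by apply: upi_eq; apply: ur_scale (upi_rel _). Qed.

Let ueaP (t : uea) : exists s, t = upi s.
Proof. by exists (repr t); rewrite upi_repr. Qed.

Let uea_addA : associative uea_add.
Proof.
move=> s t u; have [s' ->] := ueaP s; have [t' ->] := ueaP t.
have [u' ->] := ueaP u; rewrite !uea_addE; exact/upi_eq/ur_addA.
Qed.
Let uea_addC : commutative uea_add.
Proof.
move=> s t; have [s' ->] := ueaP s; have [t' ->] := ueaP t.
rewrite !uea_addE; exact/upi_eq/ur_addC.
Qed.
Let uea_add0 : left_id (upi UZero) uea_add.
Proof.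
move=> t; have [t' ->] := ueaP t; rewrite uea_addE; exact/upi_eq/ur_add0.
Qed.
Let uea_addN : left_inverse (upi UZero) (uea_scale (-1)) uea_add.
Proof.
move=> t; have [t' ->] := ueaP t; rewrite uea_scaleE uea_addE.
exact/upi_eq/ur_addN.
Qed.

HB.instance Definition _ :=
  GRing.isZmodule.Build uea uea_addA uea_addC uea_add0 uea_addN.

Let uea_scaleA a b t : uea_scale a (uea_scale b t) = uea_scale (a * b) t.
Proof.
have [t' ->] := ueaP t; rewrite !uea_scaleE; exact/upi_eq/ur_scaleA.
Qed.
Let uea_scale1 : left_id 1 uea_scale.
Proof.
move=> t; have [t' ->] := ueaP t; rewrite !uea_scaleE; exact/upi_eq/ur_scale1.
Qed.
Let uea_scaleDr : right_distributive uea_scale +%R.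
Proof.
move=> a s t; have [s' ->] := ueaP s; have [t' ->] := ueaP t.
rewrite [upi s' + upi t'](uea_addE s' t') !uea_scaleE [RHS]uea_addE.
exact/upi_eq/ur_scaleDr.
Qed.
Let uea_scaleDl t : {morph uea_scale^~ t : a b / a + b}.
Proof.
move=> a b; have [t' ->] := ueaP t.
rewrite /= !uea_scaleE ![RHS]uea_addE; exact/upi_eq/ur_scaleDl.
Qed.

HB.instance Definition _ := GRing.Zmodule_isLmodule.Build K uea
  uea_scaleA uea_scale1 uea_scaleDr uea_scaleDl.

Lemma upi0 : upi UZero = 0. Proof. by []. Qed.
Lemma upiD s t : upi (UAdd s t) = upi s + upi t.
Proof. exact/esym/uea_addE. Qed.
Lemma upiZ a t : upi (UScale a t) = a *: upi t.
Proof. exact/esym/uea_scaleE. Qed.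

Let uea_mulA : associative uea_mul.
Proof.
move=> s t u; have [s' ->] := ueaP s; have [t' ->] := ueaP t.
have [u' ->] := ueaP u; rewrite !uea_mulE; exact/upi_eq/ur_mulA.
Qed.
Let uea_mul1l : left_id (upi UOne) uea_mul.
Proof.
move=> t; have [t' ->] := ueaP t; rewrite uea_mulE; exact/upi_eq/ur_mul1l.
Qed.
Let uea_mul1r : right_id (upi UOne) uea_mul.
Proof.
move=> t; have [t' ->] := ueaP t; rewrite uea_mulE; exact/upi_eq/ur_mul1r.
Qed.
Let uea_mulDl : left_distributive uea_mul +%R.
Proof.
move=> s t u; have [s' ->] := ueaP s; have [t' ->] := ueaP t.
have [u' ->] := ueaP u; rewrite -upiD !uea_mulE -upiD; exact/upi_eq/ur_mulDl.
Qed.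
Let uea_mulDr : right_distributive uea_mul +%R.
Proof.
move=> s t u; have [s' ->] := ueaP s; have [t' ->] := ueaP t.
have [u' ->] := ueaP u; rewrite -upiD !uea_mulE -upiD; exact/upi_eq/ur_mulDr.
Qed.

Fixpoint counit_term (t : term) : K :=
  match t with
  | UZero => 0
  | UOne => 1
  | UAdd s u => counit_term s + counit_term u
  | UMul s u => counit_term s * counit_term u
  | UScale a s => a * counit_term s
  | UGen _ => 0
  end.

Lemma counit_term_rel s t : uea_rel br s t -> counit_term s = counit_term t.
Proof.
elim=> //=; try by move=> *; congruence.
- by move=> *; rewrite addrA.
- by move=> *; rewrite addrC.
- by move=> *; rewrite add0r.
- by move=> *; rewrite mulN1r addNr.
- by move=> *; rewrite mulrA.
- by move=> *; rewrite mul1r.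
- by move=> *; rewrite mulr1.
- by move=> *; rewrite mulrDl.
- by move=> *; rewrite mulrDr.
- by move=> *; rewrite mulrA.
- by move=> *; rewrite mul1r.
- by move=> *; rewrite mulrDr.
- by move=> *; rewrite mulrDl.
- by move=> *; rewrite mulrA.
- by move=> *; rewrite mulrCA.
- by move=> *; rewrite addr0.
- by move=> *; rewrite mulr0.
- by move=> *; rewrite mulr0 addr0.
Qed.

(* The counit: the algebra morphism which vanishes on V. *)
Definition ueps (u : uea) : K := counit_term (repr u).

Lemma ueps_upi t : ueps (upi t) = counit_term t.
Proof. exact/counit_term_rel/upi_rel. Qed.

Let uea_neq0 : upi UOne != 0.
Proof.
apply/eqP => /(congr1 ueps); rewrite -upi0 !ueps_upi /=.
by apply/eqP; rewrite oner_neq0.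
Qed.

HB.instance Definition _ := GRing.Zmodule_isNzRing.Build uea
  uea_mulA uea_mul1l uea_mul1r uea_mulDl uea_mulDr uea_neq0.

Lemma upi1 : upi UOne = 1. Proof. by []. Qed.
Lemma upiM s t : upi (UMul s t) = upi s * upi t.
Proof. exact/esym/uea_mulE. Qed.

Let uea_scaleAl (a : K) (s t : uea) : a *: (s * t) = a *: s * t.
Proof.
have [s' ->] := ueaP s; have [t' ->] := ueaP t.
rewrite -upiM -!upiZ -upiM; exact/upi_eq/ur_scaleMl.
Qed.
HB.instance Definition _ := GRing.Lmodule_isLalgebra.Build K uea uea_scaleAl.

Let uea_scaleAr (a : K) (s t : uea) : a *: (s * t) = s * (a *: t).
Proof.
have [s' ->] := ueaP s; have [t' ->] := ueaP t.
rewrite -upiM -!upiZ -upiM; exact/upi_eq/ur_scaleMr.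
Qed.
HB.instance Definition _ := GRing.Lalgebra_isAlgebra.Build K uea uea_scaleAr.

Lemma ueps0 : ueps 0 = 0. Proof. by rewrite -upi0 ueps_upi. Qed.
Lemma ueps1 : ueps 1 = 1. Proof. by rewrite -upi1 ueps_upi. Qed.
Lemma uepsD s t : ueps (s + t) = ueps s + ueps t.
Proof.
have [s' ->] := ueaP s; have [t' ->] := ueaP t.
by rewrite -upiD !ueps_upi.
Qed.
Lemma uepsZ a t : ueps (a *: t) = a * ueps t.
Proof. by have [t' ->] := ueaP t; rewrite -upiZ !ueps_upi. Qed.
Lemma uepsM s t : ueps (s * t) = ueps s * ueps t.
Proof.
have [s' ->] := ueaP s; have [t' ->] := ueaP t.
by rewrite -upiM !ueps_upi.
Qed.
Lemma ueps_uin x : ueps (uin x) = 0. Proof. exact: ueps_upi. Qed.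

Lemma uinD x y : uin (x + y) = uin x + uin y.
Proof. by rewrite -upiD; apply/upi_eq/ur_genD. Qed.
Lemma uinZ a x : uin (a *: x) = a *: uin x.
Proof. by rewrite -upiZ; apply/upi_eq/ur_genZ. Qed.
Lemma uin_lie x y : uin (br x y) = uin x * uin y - uin y * uin x.
Proof.
apply/eqP; rewrite eq_sym subr_eq addrC -!upiM -upiD; apply/eqP.
exact/upi_eq/ur_lie.
Qed.

Lemma uea_ind (P : uea -> Prop) :
  P 0 -> P 1 -> (forall s t, P s -> P t -> P (s + t)) ->
  (forall s t, P s -> P t -> P (s * t)) ->
  (forall a t, P t -> P (a *: t)) -> (forall x, P (uin x)) ->
  forall u, P u.
Proof.
move=> P0 P1 PD PM PZ Px u; have [s ->] := ueaP u; elim: s => //.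
- by move=> s Ps t Pt; rewrite upiD; apply: PD.
- by move=> s Ps t Pt; rewrite upiM; apply: PM.
- by move=> a s Ps; rewrite upiZ; apply: PZ.
Qed.

Section Lift.
Variable A : algType K.

Definition lie_map (f : V -> A) : Prop :=
  linear f /\ forall x y, f (br x y) = f x * f y - f y * f x.

Fixpoint uea_eval (f : V -> A) (t : term) : A :=
  match t with
  | UZero => 0
  | UOne => 1
  | UAdd s u => uea_eval f s + uea_eval f u
  | UMul s u => uea_eval f s * uea_eval f u
  | UScale a s => a *: uea_eval f s
  | UGen x => f x
  end.

(* The algebra morphism which extends f; only meaningful when lie_map f. *)
Definition ulift (f : V -> A) (u : uea) : A := uea_eval f (repr u).

Variable f : V -> A.
Hypothesis fP : lie_map f.

Lemma uea_eval_rel s t : uea_rel br s t -> uea_eval f s = uea_eval f t.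
Proof.
have [fL fb] := fP.
have fD : {morph f : x y / x + y}.
  by move=> x y; have := fL 1 x y; rewrite !scale1r.
have f0 : f 0 = 0 by apply: (addrI (f 0)); rewrite -fD !addr0.
elim=> //=; try by move=> *; congruence.
- by move=> *; rewrite addrA.
- by move=> *; rewrite addrC.
- by move=> *; rewrite add0r.
- by move=> *; rewrite scaleN1r addNr.
- by move=> *; rewrite mulrA.
- by move=> *; rewrite mul1r.
- by move=> *; rewrite mulr1.
- by move=> *; rewrite mulrDl.
- by move=> *; rewrite mulrDr.
- by move=> *; rewrite scalerA.
- by move=> *; rewrite scale1r.
- by move=> *; rewrite scalerDr.
- by move=> *; rewrite scalerDl.
- by move=> *; rewrite scalerAl.
- by move=> *; rewrite scalerAr.
- by move=> a x; have := fL a x 0; rewrite !addr0 f0 addr0.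
- by move=> x y; rewrite fb addrC subrK.
Qed.

Lemma ulift_upi t : ulift f (upi t) = uea_eval f t.
Proof. exact/uea_eval_rel/upi_rel. Qed.
Lemma ulift0 : ulift f 0 = 0. Proof. by rewrite -upi0 ulift_upi. Qed.
Lemma ulift1 : ulift f 1 = 1. Proof. by rewrite -upi1 ulift_upi. Qed.
Lemma uliftD s t : ulift f (s + t) = ulift f s + ulift f t.
Proof.
have [s' ->] := ueaP s; have [t' ->] := ueaP t.
by rewrite -upiD !ulift_upi.
Qed.
Lemma uliftM s t : ulift f (s * t) = ulift f s * ulift f t.
Proof.
have [s' ->] := ueaP s; have [t' ->] := ueaP t.
by rewrite -upiM !ulift_upi.
Qed.
Lemma uliftZ a t : ulift f (a *: t) = a *: ulift f t.
Proof. by have [t' ->] := ueaP t; rewrite -upiZ !ulift_upi. Qed.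
Lemma ulift_uin x : ulift f (uin x) = f x.
Proof. exact: ulift_upi. Qed.

Lemma ulift_unique (F : {lrmorphism uea -> A}) :
  (forall x, F (uin x) = f x) -> F =1 ulift f.
Proof.
move=> Fx; elim/uea_ind => [||s t|s t|a t|x].
- by rewrite rmorph0 ulift0.
- by rewrite rmorph1 ulift1.
- by move=> Hs Ht; rewrite rmorphD uliftD; congr (_ + _).
- by move=> Hs Ht; rewrite rmorphM uliftM; congr (_ * _).
- by move=> Ht; rewrite linearZ uliftZ; congr (_ *: _).
- by rewrite Fx ulift_uin.
Qed.
End Lift.
End UEA.

Definition tprod (K : fieldType) (X Y : lmodType K)
    (mX : X -> X -> X) (mY : Y -> Y -> Y) (s t : X ⊗ Y) : X ⊗ Y :=
  tlift (fun a b => tlift (fun c d => mX a c ⊗ mY b d) t) s.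

Section TensorAlgebra.
Variables (K : fieldType) (A B : algType K).

Definition tmul : A ⊗ B -> A ⊗ B -> A ⊗ B := tprod *%R *%R.

Let tmul_inner a b : bilin (fun c d => (a * c) ⊗ (b * d) : A ⊗ B).
Proof.
by split=> [d|c] k x y; rewrite mulrDr -scalerAr
  ?tpureDl ?tpureDr ?tpureZl ?tpureZr.
Qed.

Let tmul_outer t :
  bilin (fun a b => tlift (fun c d => (a * c) ⊗ (b * d) : A ⊗ B) t).
Proof.
split=> [b|a] k x y; elim/tensor_ind: t => [|s t Hs Ht|l t Ht|c d].
- by rewrite !(tlift0 (tmul_inner _ _)) scaler0 addr0.
- rewrite !(tliftD (tmul_inner _ _)) Hs Ht scalerDr.
  by rewrite -!addrA; congr (_ + _); rewrite addrCA.
- by rewrite !(tliftZ (tmul_inner _ _)) Ht scalerDr !scalerA mulrC.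
- by rewrite !(tlift_pure (tmul_inner _ _)) mulrDl -scalerAl tpureDl tpureZl.
- by rewrite !(tlift0 (tmul_inner _ _)) scaler0 addr0.
- rewrite !(tliftD (tmul_inner _ _)) Hs Ht scalerDr.
  by rewrite -!addrA; congr (_ + _); rewrite addrCA.
- by rewrite !(tliftZ (tmul_inner _ _)) Ht scalerDr !scalerA mulrC.
- by rewrite !(tlift_pure (tmul_inner _ _)) mulrDl -scalerAl tpureDr tpureZr.
Qed.

Lemma tmul_pure a b c d : tmul (a ⊗ b) (c ⊗ d) = (a * c) ⊗ (b * d).
Proof. by rewrite /tmul /tprod (tlift_pure (tmul_outer _)) (tlift_pure (tmul_inner _ _)). Qed.
Lemma tmul0l t : tmul 0 t = 0. Proof. exact: (tlift0 (tmul_outer t)). Qed.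
Lemma tmulDl : left_distributive tmul +%R.
Proof. by move=> s t u; exact: (tliftD (tmul_outer u)). Qed.
Lemma tmulZl k s t : tmul (k *: s) t = k *: tmul s t.
Proof. exact: (tliftZ (tmul_outer t)). Qed.

Lemma tmul_lin s : linear (tmul s).
Proof.
move=> k x y; elim/tensor_ind: s => [|s t Hs Ht|l t Ht|a b].
- by rewrite !tmul0l scaler0 addr0.
- by rewrite !tmulDl Hs Ht scalerDr -!addrA; congr (_ + _); rewrite addrCA.
- by rewrite !tmulZl Ht scalerDr !scalerA mulrC.
- by rewrite /tmul /tprod !(tlift_pure (tmul_outer _)) (tlift_linear (tmul_inner a b)).
Qed.
Lemma tmulDr : right_distributive tmul +%R.
Proof. by move=> s t u; have := tmul_lin s 1 t u; rewrite !scale1r. Qed.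
Lemma tmul0r s : tmul s 0 = 0.
Proof. by apply: (addrI (tmul s 0)); rewrite -tmulDr !addr0. Qed.
Lemma tmulZr k s t : tmul s (k *: t) = k *: tmul s t.
Proof. by have := tmul_lin s k t 0; rewrite !addr0 tmul0r addr0. Qed.

Lemma tmulA : associative tmul.
Proof.
elim/tensor_ind => [|s s' Hs Hs'|k s Hs|a b] t u.
- by rewrite !tmul0l.
- by rewrite !tmulDl Hs Hs'.
- by rewrite !tmulZl Hs.
elim/tensor_ind: t => [|s s' Hs Hs'|k s Hs|c d].
- by rewrite !(tmul0l, tmul0r).
- by rewrite !(tmulDl, tmulDr) Hs Hs'.
- by rewrite !(tmulZl, tmulZr) Hs.
elim/tensor_ind: u => [|s s' Hs Hs'|k s Hs|e f].
- by rewrite !tmul0r.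
- by rewrite !tmulDr Hs Hs'.
- by rewrite !tmulZr Hs.
by rewrite !tmul_pure !mulrA.
Qed.

Lemma tmul1l : left_id (1 ⊗ 1) tmul.
Proof.
elim/tensor_ind => [|s s' Hs Hs'|k s Hs|e f].
- by rewrite tmul0r.
- by rewrite tmulDr Hs Hs'.
- by rewrite tmulZr Hs.
by rewrite tmul_pure !mul1r.
Qed.
Lemma tmul1r : right_id (1 ⊗ 1) tmul.
Proof.
elim/tensor_ind => [|s s' Hs Hs'|k s Hs|e f].
- by rewrite tmul0l.
- by rewrite tmulDl Hs Hs'.
- by rewrite tmulZl Hs.
by rewrite tmul_pure !mulr1.
Qed.
End TensorAlgebra.

Section UEACoproduct.
Variables (K : fieldType) (V : lmodType K) (br : V -> V -> V).
Local Notation U := (uea br).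

Let tens_one_neq0 : (1 : U) ⊗ (1 : U) != 0.
Proof.
have bP : bilin (fun a b : U => ueps a * ueps b : K^o).
  split=> [y|x] k z z'; rewrite uepsD uepsZ.
    by rewrite mulrDl; congr (_ + _); exact/esym/mulrA.
  by rewrite mulrDr; congr (_ + _); exact: mulrCA.
apply/eqP => /(congr1 (tlift (fun a b : U => ueps a * ueps b : K^o))).
rewrite (tlift_pure bP) (tlift0 bP) !ueps1 mulr1.
by apply/eqP; rewrite oner_neq0.
Qed.

HB.instance Definition _ := GRing.Zmodule_isNzRing.Build (tensor U U)
  (@tmulA K U U) (@tmul1l K U U) (@tmul1r K U U)
  (@tmulDl K U U) (@tmulDr K U U) tens_one_neq0.
HB.instance Definition _ := GRing.Lmodule_isLalgebra.Build K (tensor U U)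
  (fun k s t => esym (tmulZl k s t)).
HB.instance Definition _ := GRing.Lalgebra_isAlgebra.Build K (tensor U U)
  (fun k s t => esym (tmulZr k s t)).

Definition uprim (x : V) : U ⊗ U := uin br x ⊗ 1 + 1 ⊗ uin br x.

Definition ucop : U -> U ⊗ U := ulift uprim.

Lemma uprim_lie : lie_map br uprim.
Proof.
split=> [k x y|x y].
  rewrite /uprim uinD uinZ tpureDl tpureDr tpureZl tpureZr scalerDr.
  by rewrite -!addrA; congr (_ + _); rewrite addrCA.
have E a b c d : (a ⊗ b : U ⊗ U) * (c ⊗ d) = (a * c) ⊗ (b * d).
  exact: tmul_pure.
rewrite /uprim !mulrDl !mulrDr !E !mul1r !mulr1 uin_lie.
rewrite tpureDl tpureDr -scaleN1r tpureZl tpureZr !scaleN1r.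
set p := (_ * _) ⊗ 1; set q := (_ * _) ⊗ 1; set r := _ ⊗ (_ * _).
set t := _ ⊗ (_ * _); set m := uin br x ⊗ _; set n := uin br y ⊗ _.
rewrite (addrC n r) (addrACA p m r n) (addrC m t) (addrACA q n t m) (addrC n m).
by rewrite [- (q + t + _)]opprD [RHS]addrACA subrr addr0 opprD [RHS]addrACA.
Qed.

Lemma ucop1 : ucop 1 = 1. Proof. exact: ulift1 uprim_lie. Qed.
Lemma ucopM u v : ucop (u * v) = ucop u * ucop v.
Proof. exact: uliftM uprim_lie _ _. Qed.
Lemma ucop_uin x : ucop (uin br x) = uin br x ⊗ 1 + 1 ⊗ uin br x.
Proof. exact: ulift_uin uprim_lie _. Qed.
Lemma ucop_linear : linear ucop.
Proof.
by move=> a u v; rewrite /ucop (uliftD uprim_lie) (uliftZ uprim_lie).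
Qed.
End UEACoproduct.

Section Gradings.
Variables (K : fieldType) (V : lmodType K).
Implicit Type G : nat -> set V.

Definition is_grading G : Prop :=
  [/\ forall n, G n 0 /\ (forall a x y, G n x -> G n y -> G n (a *: x + y)),
      forall v, exists N (w : nat -> V),
        (forall n, G n (w n)) /\ v = \sum_(i < N) w i
    & forall N (w : nat -> V), (forall n, G n (w n)) ->
        \sum_(i < N) w i = 0 -> forall i, (i < N)%N -> w i = 0].

Definition finite_dim (W : set V) : Prop :=
  exists d (e : 'I_d -> V), (forall i, W (e i)) /\
    forall v, W v -> exists c : 'I_d -> K, v = \sum_i c i *: e i.

Definition homogeneous0 G (m : V -> V -> V) : Prop :=
  forall i j x y, G i x -> G j y -> G (i + j)%N (m x y).
End Gradings.

(* The grading of the enveloping algebra induced by a grading G of V: in      *)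
(* degree n, the span of the products x_1 ... x_k with x_i in G n_i and       *)
(* n_1 + ... + n_k = n.                                                       *)
Inductive uea_gr (K : fieldType) (V : lmodType K) (br : V -> V -> V)
    (G : nat -> set V) : nat -> uea br -> Prop :=
| ugr0 n : uea_gr G n 0
| ugrD n u v : uea_gr G n u -> uea_gr G n v -> uea_gr G n (u + v)
| ugrZ n a u : uea_gr G n u -> uea_gr G n (a *: u)
| ugr1 : uea_gr G 0 1
| ugr_in n x : G n x -> uea_gr G n (uin br x)
| ugrM m n u v : uea_gr G m u -> uea_gr G n v -> uea_gr G (m + n) (u * v).
Arguments uea_gr {K V} br G.

(* The graded dual of a graded vector space: the linear forms which vanish on *)
(* all but finitely many homogeneous components.                              *)

Section GradedDual.
Variables (K : fieldType) (U : lmodType K) (G : nat -> set U).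

Definition gdual_pred : {pred U -> K^o} := fun f =>
  `[< linear f /\ exists N, forall n u, (N <= n)%N -> G n u -> f u = 0 >].

Record gdual := GDual { gval :> U -> K^o; _ : gval \in gdual_pred }.
HB.instance Definition _ := [isSub for gval].
HB.instance Definition _ := [Choice of gdual by <:].

Lemma gdual_submod : GRing.submod_closed gdual_pred.
Proof.
split=> [|a f g].
  apply/asboolP; split=> [a u v|]; first by rewrite /= scaler0 addr0.
  by exists 0%N.
move=> /asboolP[fL [N fN]] /asboolP[gL [M gM]]; apply/asboolP; split.
  move=> b u v; rewrite /= !fctE fL gL !scalerDr !scalerA mulrC.
  by rewrite -!addrA; congr (_ + _); rewrite addrCA.
exists (maxn N M) => n u; rewrite geq_max => /andP[Nn Mn] Gu.
by rewrite !fctE (fN n) // (gM n) // scaler0 addr0.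
Qed.

HB.instance Definition _ :=
  GRing.isSubmodClosed.Build K (U -> K^o) gdual_pred gdual_submod.
HB.instance Definition _ := [SubChoice_isSubLmodule of gdual by <:].

Lemma gdualP (x : gdual) : gval x \in gdual_pred. Proof. exact: valP. Qed.

(* The pairing of A ⊗ B with t. *)
Definition pair2 (A B : U) (t : gdual ⊗ gdual) : K :=
  tlift (fun x y : gdual => x A * y B : K^o) t.

Definition is_dual (m : U -> U -> U) (D : gdual -> gdual ⊗ gdual) : Prop :=
  forall (x : gdual) A B, x (m A B) = pair2 A B (D x).

(* The map dual to the product m: the pairing being nondegenerate, there is   *)
(* at most one t with the required property, and there is one when m is       *)
(* bilinear and homogeneous and U has finite-dimensional components.          *)
Definition dual_cop (m : U -> U -> U) (x : gdual) : gdual ⊗ gdual :=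
  xget 0 [set t | forall A B, x (m A B) = pair2 A B t].
End GradedDual.

Section GradedDualUEA.
Variables (K : fieldType) (V : lmodType K) (br : V -> V -> V).
Variable G : nat -> set V.
Local Notation U := (uea br).
Local Notation D := (gdual (uea_gr br G)).

Inductive tens_gr : nat -> U ⊗ U -> Prop :=
| tgr0 n : tens_gr n 0
| tgrD n s t : tens_gr n s -> tens_gr n t -> tens_gr n (s + t)
| tgrZ n a t : tens_gr n t -> tens_gr n (a *: t)
| tgr_pure i j u v :
    uea_gr br G i u -> uea_gr br G j v -> tens_gr (i + j) (u ⊗ v).

Lemma tens_grM m n s t : tens_gr m s -> tens_gr n t -> tens_gr (m + n) (s * t).
Proof.
move=> Hs Ht; elim: Hs => {m s} [m|m s s' _ Hs _ Hs'|m a s _ Hs|i j u v Hu Hv].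
- by rewrite mul0r; apply: tgr0.
- by rewrite mulrDl; apply: tgrD.
- by rewrite -scalerAl; apply: tgrZ.
elim: Ht => {n t} [n|n t t' _ IHt _ IHt'|n a t _ IHt|k l u' v' Hu' Hv'].
- by rewrite mulr0; apply: tgr0.
- by rewrite mulrDr; apply: tgrD.
- by rewrite -scalerAr; apply: tgrZ.
rewrite [_ * _]tmul_pure addnACA.
by apply: tgr_pure; apply: ugrM.
Qed.

Lemma ucop_gr n u : uea_gr br G n u -> tens_gr n (ucop u).
Proof.
have L := @ucop_linear _ _ br.
have c0 : ucop (0 : U) = 0 by exact: ulift0 (uprim_lie br).
elim=> {n u} [n|n u v _ Hu _ Hv|n a u _ Hu||n x Gx|m n u v _ Hu _ Hv].
- by rewrite c0; apply: tgr0.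
- by have := L 1 u v; rewrite !scale1r => ->; apply: tgrD.
- by have := L a u 0; rewrite c0 !addr0 => ->; apply: tgrZ.
- by rewrite ucop1 -[0%N]addn0; apply: tgr_pure; apply: ugr1.
- rewrite ucop_uin; apply: tgrD.
    by rewrite -[n]addn0; apply: tgr_pure; [apply: ugr_in|apply: ugr1].
  by rewrite -[n]add0n; apply: tgr_pure; [apply: ugr1|apply: ugr_in].
- by rewrite ucopM; apply: tens_grM.
Qed.

Lemma bilin_forms (f g : U -> K^o) : linear f -> linear g ->
  bilin (fun a b => f a * g b : K^o).
Proof.
move=> fL gL; split=> [b|a] k x y.
  by rewrite fL mulrDl; congr (_ + _); exact/esym/mulrA.
by rewrite gL mulrDr; congr (_ + _); exact: mulrCA.
Qed.

Definition shuffle_fun (f g : D) (u : U) : K^o :=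
  tlift (fun a b => f a * g b : K^o) (ucop u).

Lemma shuffle_subproof f g : shuffle_fun f g \in gdual_pred (uea_gr br G).
Proof.
have /asboolP[fL [N fN]] := gdualP f; have /asboolP[gL [M gM]] := gdualP g.
have bP := bilin_forms fL gL; apply/asboolP; split.
  by move=> k u v; rewrite /shuffle_fun ucop_linear (tlift_linear bP).
exists (N + M)%N => n u NMn /ucop_gr; rewrite /shuffle_fun.
move: (ucop u) => t Ht; elim: Ht NMn => {n u t}.
- by move=> n _; rewrite (tlift0 bP).
- by move=> n s t _ Hs _ Ht Hn; rewrite (tliftD bP) Hs // Ht // addr0.
- by move=> n a t _ Ht Hn; rewrite (tliftZ bP) Ht // scaler0.
- move=> i j u v Hu Hv Hn; rewrite (tlift_pure bP).
  have [Ni|iN] := leqP N i; first by rewrite (fN i) // mul0r.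
  rewrite (gM j) ?mulr0 //; rewrite -(leq_add2l N); apply: leq_trans Hn _.
  by rewrite leq_add2r ltnW.
Qed.
Definition shuffle (f g : D) : D := GDual (shuffle_subproof f g).

Lemma gone_subproof : (@ueps K V br : U -> K^o) \in gdual_pred (uea_gr br G).
Proof.
apply/asboolP; split; first by move=> a u v; rewrite uepsD uepsZ.
exists 1%N => n u + Gu; elim: Gu => {n u}.
- by move=> n _; rewrite ueps0.
- by move=> n u v _ Hu _ Hv n0; rewrite uepsD Hu // Hv // addr0.
- by move=> n a u _ Hu n0; rewrite uepsZ Hu // mulr0.
- by [].
- by move=> n x _ _; rewrite ueps_uin.
- move=> m n u v _ Hu _ Hv; rewrite addn_gt0 uepsM => /orP[/Hu|/Hv] ->.
    by rewrite mul0r.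
  by rewrite mulr0.
Qed.
Definition gone : D := GDual gone_subproof.
End GradedDualUEA.

(* In the counit and coaction axioms below, K ⊗ W and W ⊗ K are identified    *)
(* with W, so that (counit ⊗ id) t is written tlift (fun a b => counit a *: b) t. *)

Record bialg_data (K : fieldType) := BialgData {
  bcar :> lmodType K;
  bmul : bcar -> bcar -> bcar;
  bone : bcar;
  bcomul : bcar -> bcar ⊗ bcar;
  bcounit : bcar -> K }.
Arguments bone {K}.
Arguments bmul {K b}.
Arguments bcomul {K b}.
Arguments bcounit {K b}.

Record is_bialgebra (K : fieldType) (B : bialg_data K) : Prop := {
  bmul_bilin : bilin (@bmul K B);
  bmulA : associative (@bmul K B);
  bmul1l : left_id (bone B) bmul;
  bmul1r : right_id (bone B) bmul;
  bcomul_linear : linear (@bcomul K B);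
  bcomulA : forall x : B,
    tassoc (tmap bcomul id (bcomul x)) = tmap id bcomul (bcomul x);
  bcounit_linear : scalar (@bcounit K B);
  bcounitl : forall x : B, tlift (fun a b => bcounit a *: b) (bcomul x) = x;
  bcounitr : forall x : B, tlift (fun a b => bcounit b *: a) (bcomul x) = x;
  bcomul1 : bcomul (bone B) = bone B ⊗ bone B;
  bcomulM : forall x y : B,
    bcomul (bmul x y) = tprod bmul bmul (bcomul x) (bcomul y);
  bcounit1 : bcounit (bone B) = 1;
  bcounitM : forall x y : B, bcounit (bmul x y) = bcounit x * bcounit y }.

Section Cointeraction.
Variables (K : fieldType) (A B : bialg_data K) (rho : A -> B ⊗ A).

Record is_coaction : Prop := {
  coact_linear : linear rho;
  coactA : forall x, tassoc (tmap bcomul id (rho x)) = tmap id rho (rho x);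
  coact1 : forall x, tlift (fun b a => bcounit b *: a) (rho x) = x }.

Definition m13 : (B ⊗ A) ⊗ (B ⊗ A) -> B ⊗ (A ⊗ A) :=
  tlift (fun s t => tlift (fun a b => tlift (fun c d =>
    bmul a c ⊗ (b ⊗ d)) t) s).

Record cointeraction : Prop := {
  coint_bialgA : is_bialgebra A;
  coint_bialgB : is_bialgebra B;
  coint_coaction : is_coaction;
  coint_one : rho (bone A) = bone B ⊗ bone A;
  coint_mul : forall x y : A, rho (bmul x y) = tprod bmul bmul (rho x) (rho y);
  coint_counit : forall x : A,
    tlift (fun b a => bcounit a *: b) (rho x) = bcounit x *: bone B;
  coint_comul : forall x : A,
    tmap id bcomul (rho x) = m13 (tmap rho rho (bcomul x)) }.
End Cointeraction.

Record is_post_lie (K : fieldType) (V : lmodType K)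
    (br tri : {bilinear V -> V -> V}) : Prop := {
  lie_alt : forall x, br x x = 0;
  lie_jacobi : forall x y z, br x (br y z) + br y (br z x) + br z (br x y) = 0;
  post_lie_br_tri : forall x y z,
    tri (br x y) z =
    tri x (tri y z) - tri (tri x y) z - tri y (tri x z) + tri (tri y x) z;
  post_lie_tri_br : forall x y z,
    tri x (br y z) = br (tri x y) z + br y (tri x z) }.

Arguments is_coaction {K} A B rho.
Arguments cointeraction {K} A B rho.

Section GuinOudom.
Variables (K : fieldType) (V : lmodType K) (br tri : {bilinear V -> V -> V}).
Local Notation U := (uea br).

Record guin_oudom (T : U -> U -> U) : Prop := {
  go_ext : forall x y, T (uin br x) (uin br y) = uin br (tri x y);
  go_1l : forall A, T 1 A = A;
  go_1r : forall A, T A 1 = ueps A *: 1;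
  go_mull : forall x A y,
    T (uin br x * A) (uin br y) =
    T (uin br x) (T A (uin br y)) - T (T (uin br x) A) (uin br y);
  go_mulr : forall A B C,
    T A (B * C) = tlift (fun A1 A2 => T A1 B * T A2 C) (ucop A) }.

Definition go_star (T : U -> U -> U) (A B : U) : U :=
  tlift (fun A1 A2 => A1 * T A2 B) (ucop A).

Variable G : nat -> set V.
Local Notation D := (gdual (uea_gr br G)).

(* The graded dual of (uea br, m, ucop), for a product m on uea br with unit  *)
(* 1, and with counit ueps.                                                   *)
Definition dual_bialg (m : U -> U -> U) : bialg_data K :=
  @BialgData K D (@shuffle K V br G) (gone br G) (dual_cop m) (fun x => x 1).

Definition HTdual : bialg_data K := dual_bialg *%R.

Definition Hdual (T : U -> U -> U) : bialg_data K := dual_bialg (go_star T).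
End GuinOudom.

(* Main.v *)
(* The product x * A of a letter x with A is x A + (x ▷ A), and x ▷ A is a    *)
(* combination of words no longer than A, so U is generated by 1 under left   *)
(* *-multiplication by letters.  Since x ▷ - is a derivation and a            *)
(* coderivation, induction along this generation gives all properties of *    *)
(* and ▷: from (x * A) ▷ B = x ▷ (A ▷ B) and (x * A) * B = x * (A * B) follow *)
(* (A * B) ▷ C = A ▷ (B ▷ C), the associativity of *, and the compatibility   *)
(* of * and ▷ with the coproduct and the counit.                              *)
(*                                                                            *)
(* Each axiom of a bialgebra or of a cointeraction is the transpose of one of *)
(* these identities, because the pairings of D ⊗ D and D ⊗ (D ⊗ D), D being   *)
(* the graded dual, with pairs and triples of elements of U separate tensors. *)
(* The transpose of a homogeneous product m exists since, for x in D, the     *)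
(* form x (m A B) has finite rank.                                            *)

From HB Require Import structures.
Require Import Defs.
From mathcomp Require Import all_boot all_order all_algebra ssrAC sesquilinear.
From mathcomp Require Import boolp classical_sets functions.

Set Implicit Arguments.
Unset Strict Implicit.
Unset Printing Implicit Defensive.

Import GRing.Theory.
Local Open Scope ring_scope.

(** * Linear maps and tensors *)

(** All identities are proved on [U], for [T] (written ▷) and [go_star] (written ∗), and then
    transposed.

    On [U], left ∗-multiplication by a letter x is A ↦ xA + x ▷ A ([star_prim]) and is a
    coderivation of the coproduct ([ucop_star_prim]). Since 1 and these operators generate [U]
    ([star_ind]), it is enough to treat one letter at a time: (x ∗ A) ▷ B = x ▷ (A ▷ B)
    ([go_star_primE]) and (x ∗ A) ∗ B = x ∗ (A ∗ B) ([star_primA]) yield the action law [go_action],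
    associativity [starA], and the compatibility of ▷ and ∗ with coproduct and counit ([ucop_go],
    [ucop_star], [ueps_go], [ueps_star]).

    On the dual side, [pair2_inj] and [pair3_inj] turn an equation between tensors into an identity
    on [U]; both rest on [tensor_sep]. Transposes exist by [is_dual_ex], from homogeneity ([go_gr],
    [go_star_gr]) and finite-dimensional components ([uea_gr_fin]). The coaction axioms then become
    [go_action] and 1 ▷ A = A. The four cointeraction axioms become, in order, [ueps_go], [ucop_go],
    A ▷ 1 = ε(A)1, and the rule for A ▷ BC. *)

Section Linear.
Variables (K : fieldType) (X Y Z W : lmodType K).

Lemma linear_idfun : linear (fun x : X => x). Proof. by []. Qed.

Lemma linear_comp (g : Y -> Z) (f : X -> Y) :
  linear g -> linear f -> linear (fun x => g (f x)).
Proof. by move=> gL fL a u v; rewrite fL gL. Qed.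

Lemma linear_add (f g : X -> Y) :
  linear f -> linear g -> linear (fun x => f x + g x).
Proof. by move=> fL gL a u v; rewrite fL gL scalerDr addrACA. Qed.

Lemma linear_scale b (f : X -> Y) : linear f -> linear (fun x => b *: f x).
Proof. by move=> fL a u v; rewrite fL scalerDr !scalerA mulrC. Qed.

Lemma linear_scalel (f : X -> K^o) (y : Y) :
  linear f -> linear (fun x => (f x : K) *: y).
Proof. by move=> fL a u v; rewrite fL scalerDl scalerA. Qed.

Lemma linear_mull (A : algType K) (f : X -> A) c :
  linear f -> linear (fun x => f x * c).
Proof. by move=> fL a u v; rewrite fL mulrDl scalerAl. Qed.

Lemma linear_mulr (A : algType K) (f : X -> A) c :
  linear f -> linear (fun x => c * f x).
Proof. by move=> fL a u v; rewrite fL mulrDr scalerAr. Qed.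

Lemma linear_mulKl (f : X -> K^o) (c : K) :
  linear f -> linear (fun x => (f x : K) * c : K^o).
Proof. by move=> fL a u v; rewrite fL mulrDl -mulrA. Qed.

Lemma linear_mulKr (f : X -> K^o) (c : K) :
  linear f -> linear (fun x => c * (f x : K) : K^o).
Proof. by move=> fL a u v; rewrite fL mulrDr mulrCA. Qed.

Lemma linear_tpurel (f : X -> Y) (z : Z) :
  linear f -> linear (fun x => f x ⊗ z).
Proof. by move=> fL a u v; rewrite fL tpureDl tpureZl. Qed.

Lemma linear_tpurer (f : X -> Y) (z : Z) :
  linear f -> linear (fun x => z ⊗ f x).
Proof. by move=> fL a u v; rewrite fL tpureDr tpureZr. Qed.

Lemma linear_bilinl (b : Y -> Z -> W) (f : X -> Y) z :
  bilin b -> linear f -> linear (fun x => b (f x) z).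
Proof. by move=> [bL _] fL a u v; rewrite fL bL. Qed.

Lemma linear_bilinr (b : Y -> Z -> W) (f : X -> Z) y :
  bilin b -> linear f -> linear (fun x => b y (f x)).
Proof. by move=> [_ bL] fL a u v; rewrite fL bL. Qed.

Lemma linear0_eq (f : X -> Y) : linear f -> f 0 = 0.
Proof. by move=> fL; have := fL (-1) 0 0; rewrite addr0 !scaleN1r oppr0 addNr. Qed.

Lemma linearD_eq (f : X -> Y) : linear f -> {morph f : u v / u + v}.
Proof. by move=> fL u v; have := fL 1 u v; rewrite !scale1r. Qed.

Lemma linearZ_eq (f : X -> Y) : linear f -> forall a, {morph f : u / a *: u}.
Proof. by move=> fL a u; have := fL a u 0; rewrite (linear0_eq fL) !addr0. Qed.

Lemma linearN_eq (f : X -> Y) : linear f -> {morph f : u / - u}.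
Proof. by move=> fL u; rewrite -scaleN1r (linearZ_eq fL) scaleN1r. Qed.

Lemma linear_sum_eq (f : X -> Y) (I : Type) (r : seq I) (F : I -> X) :
  linear f -> f (\sum_(i <- r) F i) = \sum_(i <- r) f (F i).
Proof.
move=> fL; elim: r => [|i r IH]; first by rewrite !big_nil (linear0_eq fL).
by rewrite !big_cons (linearD_eq fL) IH.
Qed.

End Linear.

Lemma tensor_ext (K : fieldType) (X Y Z : lmodType K) (f g : X ⊗ Y -> Z) :
  linear f -> linear g ->
  (forall x y, f (x ⊗ y) = g (x ⊗ y)) -> f =1 g.
Proof.
move=> fL gL fg; elim/tensor_ind => [|s t Hs Ht|a t Ht|//].
- by rewrite (linear0_eq fL) (linear0_eq gL).
- by rewrite (linearD_eq fL) (linearD_eq gL) Hs Ht.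
- by rewrite (linearZ_eq fL) (linearZ_eq gL) Ht.
Qed.

Lemma tpure0l (K : fieldType) (X Y : lmodType K) (y : Y) : (0 : X) ⊗ y = 0.
Proof. by rewrite -(scale0r (0 : X)) tpureZl scale0r. Qed.

Lemma tpure0r (K : fieldType) (X Y : lmodType K) (x : X) : x ⊗ (0 : Y) = 0.
Proof. by rewrite -(scale0r (0 : Y)) tpureZr scale0r. Qed.

Lemma linear_tlift_param (K : fieldType) (W X Y Z : lmodType K)
    (b : W -> X -> Y -> Z) (t : X ⊗ Y) :
  (forall w, bilin (b w)) -> (forall x y, linear (fun w => b w x y)) ->
  linear (fun w => tlift (b w) t).
Proof.
move=> bP bL a u v; move: t; apply: (@tensor_ext _ _ _ Z).
- exact/tlift_linear.
- apply: (linear_add (f := fun t => a *: tlift (b u) t)); last exact: tlift_linear.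
  exact/linear_scale/tlift_linear.
- by move=> x y; rewrite !tlift_pure // bL.
Qed.

Lemma bilin_mul (K : fieldType) (A : algType K) : bilin (@GRing.mul A).
Proof. by split=> w; [apply: linear_mull|apply: linear_mulr]. Qed.

Lemma linear_gval (K : fieldType) (U : lmodType K) (G : nat -> set U) (f : gdual G) :
  linear f.
Proof. by have /asboolP[] := gdualP f. Qed.

Lemma linear_eval (K : fieldType) (X U : lmodType K) (G : nat -> set U)
    (f : X -> gdual G) u :
  linear f -> linear (fun x => f x u : K^o).
Proof. by move=> fL a x y; rewrite fL. Qed.

Lemma linear_ueps (K : fieldType) (V : lmodType K) (br : V -> V -> V) :
  linear (@ueps K V br : _ -> K^o).
Proof. by move=> a u v; rewrite uepsD uepsZ. Qed.

Lemma linear_uin (K : fieldType) (V : lmodType K) (br : V -> V -> V) :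
  linear (@uin K V br).
Proof. by move=> a u v; rewrite uinD uinZ. Qed.

Definition tder (K : fieldType) (X : lmodType K) (f : X -> X) : X ⊗ X -> X ⊗ X :=
  tlift (fun a b => f a ⊗ b + a ⊗ f b).

(** Proves linearity and bilinearity by recursion on the shape of the function. Maps it does not
    know by name, such as [T] or [rho], are handled through linearity facts in the context; proofs
    introduce these beforehand. *)
Ltac lin :=
  intros; cbv beta;
  first
  [ assumption
  | match goal with
    | |- bilin _ => first [exact: bilin_mul | split=> ?; lin]
    | |- GRing.linear_for _ (fun x => x) => exact: linear_idfun
    | |- GRing.linear_for _ id => exact: linear_idfun
    | |- GRing.linear_for _ (fun x => @?f x + @?g x) =>
        apply: (linear_add (f := f) (g := g)); lin
    | |- GRing.linear_for _ (fun x => ?c *: @?f x) =>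
        apply: (linear_scale (f := f) _); lin
    | |- GRing.linear_for _ (fun x => (@?f x) *: ?c) =>
        apply: (linear_scalel (f := f)); lin
    | |- GRing.linear_for _ (fun x => @?f x ⊗ ?c) =>
        apply: (linear_tpurel (f := f)); lin
    | |- GRing.linear_for _ (fun x => ?c ⊗ @?f x) =>
        apply: (linear_tpurer (f := f)); lin
    | |- GRing.linear_for _ (tpure ?c) => exact: (bilin_pure _ _).2
    | |- GRing.linear_for _ (GRing.mul ?c) => exact: (bilin_mul _).2
    | |- GRing.linear_for _ (fun x => @?f x * ?c) =>
        first [apply: (linear_mull (f := f)) | apply: (linear_mulKl (f := f))]; lin
    | |- GRing.linear_for _ (fun x => ?c * @?f x) =>
        first [apply: (linear_mulr (f := f)) | apply: (linear_mulKr (f := f))]; lin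
    | |- GRing.linear_for _ (fun x => tlift ?b x) => apply: tlift_linear; lin
    | |- GRing.linear_for _ (tlift ?b) => apply: tlift_linear; lin
    | |- GRing.linear_for _ (fun x => tlift ?b (@?f x)) =>
        apply: (linear_comp (g := tlift b) (f := f)); lin
    | |- GRing.linear_for _ (fun x => @tlift _ _ _ ?L (@?b x) ?t) =>
        apply: (linear_tlift_param (Z := L) (b := b)); lin
    | |- GRing.linear_for _ (tmap _ _) => rewrite /tmap; lin
    | |- GRing.linear_for _ (fun x => tmap _ _ _) => rewrite /tmap; lin
    | |- GRing.linear_for _ (tder _) => rewrite /tder; lin
    | |- GRing.linear_for _ (fun x => tder _ _) => rewrite /tder; lin
    | |- GRing.linear_for _ (@tassoc _ _ _ _) => rewrite /tassoc; lin
    | |- GRing.linear_for _ (fun x => tassoc _) => rewrite /tassoc; lin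
    | |- GRing.linear_for _ (tprod _ _ _) => rewrite /tprod; lin
    | |- GRing.linear_for _ (fun x => tprod _ _ _ _) => rewrite /tprod; lin
    | |- GRing.linear_for _ (fun x => pair2 _ _ _) => rewrite /pair2; lin
    | |- GRing.linear_for _ (@ueps _ _ _) => exact: linear_ueps
    | |- GRing.linear_for _ (fun x => ueps (@?f x)) =>
        apply: (linear_comp (f := f));
        [exact: linear_ueps | lin]
    | |- GRing.linear_for _ (@ucop _ _ _) => exact: ucop_linear
    | |- GRing.linear_for _ (fun x => ucop (@?f x)) =>
        apply: (linear_comp (f := f)); [exact: ucop_linear | lin]
    | |- GRing.linear_for _ (fun x => uin _ (@?f x)) =>
        apply: (linear_comp (f := f)); [exact: linear_uin | lin]
    | |- GRing.linear_for _ (gval _) => exact: linear_gval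
    | |- GRing.linear_for _ (fun x => gval ?y (@?f x)) =>
        apply: (linear_comp (f := f)); [exact: linear_gval | lin]
    | |- GRing.linear_for _ (fun x => gval (@?f x) ?y) =>
        apply: (linear_eval (f := f)); lin
    | bP : bilin ?b |- GRing.linear_for _ (fun x => ?b (@?f x) ?c) =>
        apply: (linear_bilinl (f := f) _ bP); lin
    | bP : bilin ?b |- GRing.linear_for _ (fun x => ?b ?c (@?f x)) =>
        apply: (linear_bilinr (f := f) _ bP); lin
    | bP : bilin ?b |- GRing.linear_for _ (?b ?c) => exact: bP.2
    | bL : GRing.linear_for _ ?b |- GRing.linear_for _ (fun x => ?b (@?f x)) =>
        apply: (linear_comp (f := f) bL); lin
    end ].

Lemma tmap_pure (K : fieldType) (X Y X' Y' : lmodType K) (f : X -> X') (g : Y -> Y') x y :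
  linear f -> linear g -> tmap f g (x ⊗ y) = f x ⊗ g y.
Proof. by move=> fL gL; rewrite /tmap tlift_pure //; lin. Qed.

Lemma tder_pure (K : fieldType) (X : lmodType K) (f : X -> X) a b :
  linear f -> tder f (a ⊗ b) = f a ⊗ b + a ⊗ f b.
Proof. by move=> fL; rewrite /tder tlift_pure //; lin. Qed.

Lemma tassoc_pure (K : fieldType) (X Y Z : lmodType K) (x : X) (y : Y) (z : Z) :
  tassoc ((x ⊗ y) ⊗ z) = x ⊗ (y ⊗ z).
Proof. by rewrite /tassoc !tlift_pure //; lin. Qed.

Lemma tprod_pure (K : fieldType) (X Y : lmodType K) (m : X -> X -> X) (n : Y -> Y -> Y)
    a b c d :
  bilin m -> bilin n -> tprod m n (a ⊗ b) (c ⊗ d) = m a c ⊗ n b d.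
Proof. by move=> mP nP; rewrite /tprod !tlift_pure //; lin. Qed.

Lemma pair2_pure (K : fieldType) (U : lmodType K) (G : nat -> set U) (f g : gdual G) a b :
  pair2 a b (f ⊗ g) = f a * g b.
Proof. by rewrite /pair2 tlift_pure //; lin. Qed.

(** * Linear independence and separation of tensors *)

Section Free.
Variables (K : fieldType) (Y : lmodType K).

Lemma free_or_dependent n (g : 'I_n.+1 -> Y) :
  (forall c : 'I_n.+1 -> K, \sum_k c k *: g k = 0 -> forall k, c k = 0) \/
  exists k0 d, g k0 = \sum_k d k *: g (lift k0 k).
Proof.
have [|nfree] := pselect (forall c : 'I_n.+1 -> K,
  \sum_k c k *: g k = 0 -> forall k, c k = 0); first by left.
right; have /existsNP[c /not_implyP[c0 /existsNP[k0 /eqP ck0]]] := nfree.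
exists k0, (fun k => - ((c k0)^-1 * c (lift k0 k))).
move: c0; rewrite (bigD1_ord k0) //= => /(congr1 (fun y => (c k0)^-1 *: y)).
rewrite scalerDr scalerA mulVf // scale1r scaler0 => /eqP.
rewrite addr_eq0 => /eqP ->; rewrite scaler_sumr -sumrN.
by apply: eq_bigr => k _; rewrite scaleNr scalerA.
Qed.

End Free.

Section Separation.
Variables (K : fieldType) (X Y : lmodType K) (I J : Type).
Variables (phi : I -> X -> K^o) (psi : J -> Y -> K^o).
Hypotheses (phiL : forall i, linear (phi i)) (psiL : forall j, linear (psi j)).
Hypothesis phi_sep : forall x, (forall i, phi i x = 0) -> x = 0.
Hypothesis psi_sep : forall y, (forall j, psi j y = 0) -> y = 0.

Lemma tensor_sum (t : X ⊗ Y) :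
  exists n (f : 'I_n -> X) (g : 'I_n -> Y), t = \sum_k f k ⊗ g k.
Proof.
elim/tensor_ind: t => [|s t [n [f [g ->]]] [m [f' [g' ->]]]|a t [n [f [g ->]]]|x y].
- by exists 0%N, (fun _ => 0), (fun _ => 0); rewrite big_ord0.
- exists (n + m)%N,
    (fun k => match fintype.split k with inl i => f i | inr j => f' j end),
    (fun k => match fintype.split k with inl i => g i | inr j => g' j end).
  rewrite big_split_ord; congr (_ + _); apply: eq_bigr => k _.
    by rewrite (unsplitK (inl k)).
  by rewrite (unsplitK (inr k)).
- exists n, (fun k => a *: f k), g; rewrite scaler_sumr.
  by apply: eq_bigr => k _; rewrite tpureZl.
- by exists 1%N, (fun _ => x), (fun _ => y); rewrite big_ord1.
Qed.

(** Induction on the number of pure terms in t. If the right factors are independent, the [psi] show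
    that the combination of them with coefficients [phi i (f k)] vanishes, so every [f k] is killed
    by all [phi] and is 0. Otherwise one right factor is a combination of the others and t has a
    shorter expression. *)
Lemma tensor_sep (t : X ⊗ Y) :
  (forall i j, tlift (fun x y => phi i x * psi j y : K^o) t = 0) -> t = 0.
Proof.
have [n [f [g ->]]] := tensor_sum t.
have bP i j : bilin (fun x y => phi i x * psi j y : K^o).
  by have := phiL i; have := psiL j; lin.
elim: n f g => [|n IH] f g H; first by rewrite big_ord0.
have [free|[k0 [d gk0]]] := free_or_dependent g.
  rewrite big1 // => k _; suff -> : f k = 0 by rewrite tpure0l.
  apply: phi_sep => i; apply: (free (fun k => phi i (f k))).
  apply: psi_sep => j; rewrite (linear_sum_eq _ _ (psiL j)) -[RHS](H i j).
  rewrite (linear_sum_eq _ _ (tlift_linear (bP i j))); apply: eq_bigr => k' _.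
  by rewrite (linearZ_eq (psiL j)) tlift_pure.
have E : \sum_k f k ⊗ g k = \sum_k (f (lift k0 k) + d k *: f k0) ⊗ g (lift k0 k).
  rewrite (bigD1_ord k0) //= gk0 (linear_sum_eq (f := tpure (f k0))); last by lin.
  rewrite -big_split; apply: eq_bigr => k _ /=.
  by rewrite tpureZr tpureDl tpureZl addrC.
by rewrite E; apply: IH => i j; rewrite -E.
Qed.

End Separation.

(** * Spans and maps of finite rank *)

Inductive lspan (K : fieldType) (W : lmodType K) (s : seq W) : W -> Prop :=
| lspan0 : lspan s 0
| lspanD u v : lspan s u -> lspan s v -> lspan s (u + v)
| lspanZ a u : lspan s u -> lspan s (a *: u)
| lspan_mem u : u \in s -> lspan s u.

Section FiniteRank.
Variables (K : fieldType) (U W : lmodType K).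

Lemma lspan_sub (s s' : seq W) w : {subset s <= s'} -> lspan s w -> lspan s' w.
Proof.
move=> ss'; elim=> [|u v _ Hu _ Hv|a u _ Hu|u /ss' us'].
- exact: lspan0.
- exact: lspanD.
- exact: lspanZ.
- exact: lspan_mem.
Qed.

Lemma lspan_map (L : U -> W) s u : linear L -> lspan s u -> lspan (map L s) (L u).
Proof.
move=> LL; elim=> {u} [|u v _ Hu _ Hv|a u _ Hu|u us].
- by rewrite (linear0_eq LL); apply: lspan0.
- by rewrite (linearD_eq LL); apply: lspanD.
- by rewrite (linearZ_eq LL); apply: lspanZ.
- exact/lspan_mem/map_f.
Qed.

Lemma lspan_coord (s : seq W) w : lspan s w ->
  exists c : 'I_(size s) -> K, w = \sum_k c k *: s`_k.
Proof.
elim=> [|u v _ [c ->] _ [d ->]|a u _ [c ->]|u us].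
- by exists (fun _ => 0); rewrite big1 // => k _; rewrite scale0r.
- exists (fun k => c k + d k); rewrite -big_split.
  by apply: eq_bigr => k _; rewrite scalerDl.
- exists (fun k => a * c k); rewrite scaler_sumr.
  by apply: eq_bigr => k _; rewrite scalerA.
- have us' : (index u s < size s)%N by rewrite index_mem.
  exists (fun k => (k == Ordinal us')%:R); rewrite (bigD1 (Ordinal us')) //=.
  rewrite eqxx scale1r nth_index // big1 ?addr0 // => k /negPf ->.
  by rewrite scale0r.
Qed.

(** Dependent vectors are discarded until the family is independent. The clause that [c k] vanishes
    wherever L does will place the coordinate functions in the graded dual. *)
Lemma finite_rank (L : U -> W) n (e : 'I_n -> W) : linear L ->
  (forall u, exists c : 'I_n -> K, L u = \sum_k c k *: e k) ->
  exists m (w : 'I_m -> W) (c : 'I_m -> U -> K^o),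
  [/\ forall k, linear (c k), forall k u, L u = 0 -> c k u = 0
    & forall u, L u = \sum_k (c k u : K) *: w k].
Proof.
move=> LL; elim: n e => [|n IH] e H.
  exists 0%N, e, (fun _ _ => 0); split; [by case|by case|move=> u].
  by have [c ->] := H u; rewrite !big_ord0.
have [free|[k0 [d ek0]]] := free_or_dependent e.
  have [c cE] := boolp.choice H.
  exists n.+1, e, (fun k u => c u k); split=> //.
  (* The coordinates come from choice; they are linear because independence makes them unique. *)
  - move=> k a u v; apply/eqP; rewrite -subr_eq0; apply/eqP.
    apply: (free (fun k => c (a *: u + v) k - (a * c u k + c v k))).
    under eq_bigr do rewrite scalerBl scalerDl -scalerA.
    by rewrite sumrB big_split /= -scaler_sumr -!cE LL subrr.
  - by move=> k u Lu0; apply: (free (c u)); rewrite -cE.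
apply: (IH (fun k => e (lift k0 k))) => u; have [c ->] := H u.
exists (fun k => c (lift k0 k) + c k0 * d k).
rewrite (bigD1_ord k0) //= ek0 scaler_sumr -big_split.
by apply: eq_bigr => k _ /=; rewrite scalerDl scalerA addrC.
Qed.

End FiniteRank.

(** * The Guin-Oudom product *)

Section Words.
Variables (K : fieldType) (V : lmodType K) (br : V -> V -> V).
Local Notation U := (uea br).
Local Notation "# x" := (uin br x) (at level 1, format "# x").
Local Notation ucop := (@ucop K V br).

(** Induction on words, adding letters on the left. The product case of the structural induction
    forces the stronger claim that left multiplication by u preserves P. *)
Lemma uea_mull_ind (P : U -> Prop) : P 0 -> P 1 ->
  (forall u v, P u -> P v -> P (u + v)) -> (forall a u, P u -> P (a *: u)) ->
  (forall x u, P u -> P (#x * u)) -> forall u, P u.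
Proof.
move=> P0 P1 PD PZ PM u; rewrite -[u]mulr1.
suff: forall v, P v -> P (u * v) by apply.
elim/uea_ind: u => [v _|v Pv|s t Hs Ht v Pv|s t Hs Ht v Pv|a t Ht v Pv|x v Pv].
- by rewrite mul0r.
- by rewrite mul1r.
- by rewrite mulrDl; apply: PD; [apply: Hs|apply: Ht].
- by rewrite -mulrA; apply/Hs/Ht.
- by rewrite -scalerAl; apply/PZ/Ht.
- exact: PM.
Qed.

Lemma mul_pure (a b c d : U) : (a ⊗ b : U ⊗ U) * (c ⊗ d) = (a * c) ⊗ (b * d).
Proof. exact: tmul_pure. Qed.

Lemma ucop_one : ucop 1 = 1 ⊗ 1. Proof. exact: ucop1. Qed.

(** A letter is primitive, so left multiplication by it is a coderivation. *)
Lemma ucop_mull x A : ucop (#x * A) = tder (fun a => #x * a) (ucop A).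
Proof.
rewrite ucopM ucop_uin; move: (ucop A); apply: tensor_ext; [lin|lin|].
move=> a b; rewrite tder_pure; last by lin.
by rewrite mulrDl !mul_pure !mul1r.
Qed.

Lemma uea_ext (L : lmodType K) (f g : U -> L) : linear f -> linear g ->
  f 1 = g 1 -> (forall x u, f u = g u -> f (#x * u) = g (#x * u)) -> f =1 g.
Proof.
move=> fL gL fg1 fgM; elim/uea_mull_ind => [||u v Hu Hv|a u Hu|x u /fgM] //.
- by rewrite (linear0_eq fL) (linear0_eq gL).
- by rewrite (linearD_eq fL) (linearD_eq gL) Hu Hv.
- by rewrite (linearZ_eq fL) (linearZ_eq gL) Hu.
Qed.

Lemma ucopA A : tassoc (tmap ucop id (ucop A)) = tmap id ucop (ucop A).
Proof.
move: A; apply: uea_ext => [||/=|x u IH]; [lin|lin| |].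
  by rewrite ucop_one !tmap_pure ?ucop_one ?tassoc_pure //; lin.
have xL : linear (fun a : U => #x * a) by lin.
(* [X] multiplies by x in each of the three factors in turn; both iterated coproducts send xu to [X]
   of their value at u. *)
pose X := tlift (fun (a : U) s => (#x * a) ⊗ s + a ⊗ tder (fun a => #x * a) s).
have XL : linear X by rewrite /X; lin.
have X_pure a s : X (a ⊗ s) = (#x * a) ⊗ s + a ⊗ tder (fun a => #x * a) s.
  by rewrite /X tlift_pure //; lin.
have cL := @ucop_linear _ _ br; have iL := @linear_idfun K U.
rewrite ucop_mull; transitivity (X (tmap id ucop (ucop u))).
  rewrite -IH; move: (ucop u); apply: tensor_ext; [lin|lin|move=> a b].
  rewrite tder_pure // (linearD_eq (f := tmap ucop id)); last by lin.
  rewrite !tmap_pure // (linearD_eq (f := @tassoc _ _ _ _)); last by lin.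
  rewrite ucop_mull; move: (ucop a); apply: tensor_ext; [lin|lin|move=> c d].
  rewrite tder_pure // tpureDl (linearD_eq (f := @tassoc _ _ _ _)); last by lin.
  by rewrite !tassoc_pure X_pure tder_pure // tpureDr addrA.
move: (ucop u); apply: tensor_ext; [lin|lin|move=> a b].
rewrite tder_pure // (linearD_eq (f := tmap id ucop)); last by lin.
by rewrite !tmap_pure // X_pure ucop_mull.
Qed.

Lemma ueps_mull x (u : U) : ueps (#x * u) = 0.
Proof. by rewrite uepsM ueps_uin mul0r. Qed.

Lemma ucop_counitl A : tlift (fun a b : U => ueps a *: b) (ucop A) = A.
Proof.
have bP : bilin (fun a b : U => ueps a *: b) by lin.
move: A; apply: uea_ext => [||/=|x u IH]; [lin|lin| |].
  by rewrite ucop_one tlift_pure // ueps1 scale1r.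
rewrite -{2}IH ucop_mull; move: (ucop u); apply: tensor_ext; [lin|lin|move=> a b].
rewrite tder_pure ?(tliftD bP) ?(tlift_pure bP); last by lin.
by rewrite ueps_mull scale0r add0r scalerAr.
Qed.

Lemma ucop_counitr A : tlift (fun a b : U => ueps b *: a) (ucop A) = A.
Proof.
have bP : bilin (fun a b : U => ueps b *: a) by lin.
move: A; apply: uea_ext => [||/=|x u IH]; [lin|lin| |].
  by rewrite ucop_one tlift_pure // ueps1 scale1r.
rewrite -{2}IH ucop_mull; move: (ucop u); apply: tensor_ext; [lin|lin|move=> a b].
rewrite tder_pure ?(tliftD bP) ?(tlift_pure bP); last by lin.
by rewrite ueps_mull scale0r addr0 scalerAr.
Qed.

(* The span of the words of length at most k and total degree n. *)
Inductive uwords (G : nat -> set V) : nat -> nat -> U -> Prop :=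
| uw0 k n : uwords G k n 0
| uwD k n u v : uwords G k n u -> uwords G k n v -> uwords G k n (u + v)
| uwZ k n a u : uwords G k n u -> uwords G k n (a *: u)
| uw1 k : uwords G k 0 1
| uwM k m n x u : G m x -> uwords G k n u -> uwords G k.+1 (m + n) (#x * u).

Lemma uwords_le (G : nat -> set V) k l n u :
  (k <= l)%N -> uwords G k n u -> uwords G l n u.
Proof.
move=> + H.
elim: H l => {k n u} [k n|k n u v _ Hu _ Hv|k n a u _ Hu|k|k m n x u Gx _ Hu] l kl.
- exact: uw0.
- by apply: uwD; [apply: Hu|apply: Hv].
- exact/uwZ/Hu.
- exact: uw1.
- by case: l kl => // l kl; apply: uwM => //; apply: Hu.
Qed.

Lemma uwordsM (G : nat -> set V) k l m n u v :
  uwords G k m u -> uwords G l n v -> uwords G (k + l) (m + n) (u * v).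
Proof.
move=> + Hv; elim=> {k m u} [k m|k m u u' _ Hu _ Hu'|k m a u _ Hu|k|k m m' x u Gx _ Hu].
- by rewrite mul0r; apply: uw0.
- by rewrite mulrDl; apply: uwD.
- by rewrite -scalerAl; apply: uwZ.
- by rewrite mul1r; apply: uwords_le Hv; apply: leq_addl.
- by rewrite -mulrA addSn -addnA; apply: uwM.
Qed.

Lemma uwords_in (G : nat -> set V) n x : G n x -> uwords G 1 n #x.
Proof. by move=> Gx; rewrite -[#x]mulr1 -[n]addn0; apply: uwM Gx (uw1 _ _). Qed.

(** Supplies the length bound on which later inductions run. *)
Lemma uea_gr_uwords (G : nat -> set V) n u : uea_gr br G n u -> exists k, uwords G k n u.
Proof.
elim=> {n u} [n|n u v _ [k Hu] _ [l Hv]|n a u _ [k Hu]||n x Gx|m n u v _ [k Hu] _ [l Hv]].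
- by exists 0%N; apply: uw0.
- exists (k + l)%N; apply: uwD; first exact: uwords_le (leq_addr _ _) Hu.
  exact: uwords_le (leq_addl _ _) Hv.
- by exists k; apply: uwZ.
- by exists 0%N; apply: uw1.
- by exists 1%N; apply: uwords_in.
- by exists (k + l)%N; apply: uwordsM.
Qed.

End Words.

(** * The product ∗, its action, and the coproduct *)

Section Star.
Variables (K : fieldType) (V : lmodType K) (br tri : {bilinear V -> V -> V}).
Local Notation U := (uea br).
Local Notation "# x" := (uin br x) (at level 1, format "# x").
Local Notation ucop := (@ucop K V br).
Variable T : U -> U -> U.
Hypotheses (Tb : bilin T) (Tgo : guin_oudom tri T).
Local Notation star := (go_star T).

Lemma go_star_bilin : bilin star.
Proof. by rewrite /go_star; lin. Qed.
Let Sb := go_star_bilin.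

Lemma go_prim1 x : T #x 1 = 0.
Proof. by rewrite (go_1r Tgo) ueps_uin scale0r. Qed.

(** Primitivity of the letter turns the rule [go_mulr] into the Leibniz rule. *)
Lemma go_primM x A B : T #x (A * B) = T #x A * B + A * T #x B.
Proof.
rewrite (go_mulr Tgo) ucop_uin (tliftD (b := fun a b => T a A * T b B)); last by lin.
by rewrite !(tlift_pure (b := fun a b => T a A * T b B)) ?(go_1l Tgo) //; lin.
Qed.

Lemma star_prim x A : star #x A = #x * A + T #x A.
Proof.
rewrite /go_star ucop_uin (tliftD (b := fun a b => a * T b A)); last by lin.
by rewrite !(tlift_pure (b := fun a b => a * T b A)) ?(go_1l Tgo) ?mul1r //; lin.
Qed.

Lemma star1l A : star 1 A = A.
Proof. by rewrite /go_star ucop_one tlift_pure ?(go_1l Tgo) ?mul1r //; lin. Qed.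

(** A derivation acts on one letter of a word at a time, and x ▷ y is again a letter, so words do
    not get longer. *)
Lemma uwords_prim (G : nat -> set V) i x k n u : homogeneous0 G tri ->
  G i x -> uwords G k n u -> uwords G k (i + n) (T #x u).
Proof.
move=> Gtri Gx; have TL := Tb.2 #x.
elim=> {k n u} [k n|k n u v _ Hu _ Hv|k n a u _ Hu|k|k m n y u Gy Gu Hu].
- by rewrite (linear0_eq TL); apply: uw0.
- by rewrite (linearD_eq TL); apply: uwD.
- by rewrite (linearZ_eq TL); apply: uwZ.
- by rewrite go_prim1; apply: uw0.
- rewrite go_primM (go_ext Tgo); apply: uwD.
    by rewrite addnA; apply: uwM => //; apply: Gtri.
  by rewrite addnCA; apply: uwM.
Qed.

Lemma star_ind (P : U -> Prop) : P 1 ->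
  (forall a u v, P u -> P v -> P (a *: u + v)) ->
  (forall x u, P u -> P (star #x u)) -> forall u, P u.
Proof.
move=> P1 PL PS.
have P0 : P 0 by rewrite -[0](addNr (1 : U)) -scaleN1r; apply: PL.
have PD u v : P u -> P v -> P (u + v) by move=> *; rewrite -[u]scale1r; apply: PL.
have PZ a u : P u -> P (a *: u) by move=> *; rewrite -[_ *: _]addr0; apply: PL.
(* In degree 0 for every letter, uwords only measures the length. *)
pose G n : set V := [set x | n = 0%N]%classic.
have Gtri : homogeneous0 G tri by move=> i j x y -> ->.
have PW k n u : uwords G k n u -> P u.
  elim: k n u => [|k IH] n u; [move E: 0%N => l H|move E: k.+1 => l H];
    elim: H E => {l n u} [l n|l n u v _ Hu _ Hv|l n a u _ Hu|l|l m n x u m0 Gu _] // E.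
  1, 3: by apply: PD; [apply: Hu|apply: Hv].
  1, 2: by apply: PZ; apply: Hu.
  (* Both u and x ▷ u consist of words of length at most k, so the induction hypothesis covers both
     terms. *)
  have -> : #x * u = (-1) *: T #x u + star #x u.
    by rewrite star_prim scaleN1r addrC addrK.
  case: E Gu => <- Gu; apply: PL; last exact/PS/(IH _ _ Gu).
  exact/IH/(uwords_prim Gtri m0 Gu).
move=> u; suff [k Hk] : exists k, uwords G k 0 u by exact: PW Hk.
elim/uea_mull_ind: u => [||u v [k Hu] [l Hv]|a u [k Hu]|x u [k Hu]].
- by exists 0%N; apply: uw0.
- by exists 0%N; apply: uw1.
- exists (k + l)%N; apply: uwD; first exact: uwords_le (leq_addr _ _) Hu.
  exact: uwords_le (leq_addl _ _) Hv.
- by exists k; apply: uwZ.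
- by exists k.+1; rewrite -[0%N]addn0; apply: uwM.
Qed.

(** On a word yu, the Leibniz rule gives (x ▷ y)u + y(x ▷ u), and x ▷ y is again primitive; so
    [ucop_mull] applies to both summands. *)
Lemma ucop_go_prim x A : ucop (T #x A) = tder (T #x) (ucop A).
Proof.
have TL := Tb.2 #x; have cL := @ucop_linear _ _ br.
move: A; apply: uea_ext => [||/=|y u IH]; [lin|lin| |].
  rewrite go_prim1 ucop_one (linear0_eq cL) tder_pure // go_prim1.
  by rewrite tpure0l tpure0r addr0.
rewrite go_primM (linearD_eq cL) (go_ext Tgo) !ucop_mull IH -(go_ext Tgo).
move: (ucop u); apply: tensor_ext; [lin|lin|move=> a b].
rewrite !tder_pure ?(linearD_eq (f := tder _)) ?tder_pure //; [|lin..].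
rewrite !go_primM (go_ext Tgo) !tpureDl !tpureDr !addrA.
by rewrite [LHS](ACl (1*3*5*4*2*6)).
Qed.

Lemma ueps_go_prim x A : ueps (T #x A) = 0.
Proof.
have TL := Tb.2 #x; elim/uea_mull_ind: A => [||u v Hu Hv|a u Hu|y u Hu].
- by rewrite (linear0_eq TL) ueps0.
- by rewrite go_prim1 ueps0.
- by rewrite (linearD_eq TL) uepsD Hu Hv addr0.
- by rewrite (linearZ_eq TL) uepsZ Hu mulr0.
- by rewrite go_primM uepsD (go_ext Tgo) !ueps_mull addr0.
Qed.

Lemma ueps_star_prim x A : ueps (star #x A) = 0.
Proof. by rewrite star_prim uepsD ueps_mull ueps_go_prim addr0. Qed.

Lemma ucop_star_prim x A : ucop (star #x A) = tder (star #x) (ucop A).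
Proof.
have cL := @ucop_linear _ _ br; have TL := Tb.2 #x.
rewrite star_prim (linearD_eq cL) ucop_mull ucop_go_prim.
move: (ucop A); apply: tensor_ext; [lin|lin|move=> a b].
rewrite !tder_pure // ?star_prim; [|lin..].
by rewrite tpureDl tpureDr !addrA [LHS](ACl (1*3*2*4)).
Qed.

(** For B a letter this is [go_mull] rearranged ([TS]). For B = yB', the coproduct of x ∗ A splits
    by the coderivation property, which matches the Leibniz rule for x ▷ -. A stays general because
    its coproduct factors replace it. *)
Lemma go_star_primE x A B : T (star #x A) B = T #x (T A B).
Proof.
have TL1 A' := Tb.2 A'; have TL2 B' := Tb.1 B'.
have TS y a : T (star #x a) #y = T #x (T a #y).
  by rewrite star_prim (linearD_eq (TL2 _)) (go_mull Tgo) subrK.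
have SL := Sb.2 #x.
elim/uea_mull_ind: B A => [||B C HB HC|k B HB|y B HB] A.
- by rewrite !(linear0_eq (TL1 _)).
- by rewrite !(go_1r Tgo) (linearZ_eq (TL1 #x)) go_prim1 scaler0 ueps_star_prim scale0r.
- by rewrite !(linearD_eq (TL1 _)) HB HC.
- by rewrite !(linearZ_eq (TL1 _)) HB.
have bP : bilin (fun a b => T a #y * T b B) by lin.
rewrite !(go_mulr Tgo) ucop_star_prim.
move: (ucop A); apply: tensor_ext; [lin|lin|move=> a b].
rewrite tder_pure // (tliftD bP) !(tlift_pure bP).
by rewrite go_primM -TS -HB.
Qed.

(** By the coderivation property the left side sums (x ∗ A1)(A2 ▷ B) + A1(x ▷ (A2 ▷ B)); by
    [star_prim] and the Leibniz rule so does the right side. *)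
Lemma star_primA x A B : star (star #x A) B = star #x (star A B).
Proof.
have bP C : bilin (fun a b => a * T b C) by lin.
have SL := Sb.2 #x.
rewrite [star (star _ _) _]/go_star [star A B]/go_star ucop_star_prim.
move: (ucop A); apply: tensor_ext; [lin|lin|move=> a b].
rewrite tder_pure // (tliftD (bP B)) !(tlift_pure (bP B)).
by rewrite go_star_primE !star_prim go_primM mulrDl mulrA addrA.
Qed.

Lemma go_action A B C : T (star A B) C = T A (T B C).
Proof.
elim/star_ind: A B C => [|k u v Hu Hv|x u Hu] B C.
- by rewrite star1l (go_1l Tgo).
- by rewrite Sb.1 !Tb.1 Hu Hv.
- by rewrite star_primA !go_star_primE Hu.
Qed.

Lemma starA : associative star.
Proof.
move=> A B C; elim/star_ind: A B C => [|k u v Hu Hv|x u Hu] B C.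
- by rewrite !star1l.
- by rewrite !Sb.1 Hu Hv.
- by rewrite !star_primA Hu.
Qed.

Lemma star1r A : star A 1 = A.
Proof.
rewrite -[RHS]ucop_counitr /go_star.
move: (ucop A); apply: tensor_ext; [lin|lin|move=> a b].
rewrite !tlift_pure; [|lin..].
by rewrite (go_1r Tgo) -scalerAr mulr1.
Qed.

Section StarRecursion.
Variables (m : U -> U -> U) (n : V -> U -> U).
Hypotheses (mb : bilin m) (m1 : forall B, m 1 B = B).
Hypothesis mS : forall x A B, m (star #x A) B = n x (m A B).

(** Treats ▷ and ∗ together: [m] is either product and [n x] its left action by x. If each [n x] is
    a coderivation, the recursion [mS] makes [m] a coalgebra morphism. *)
Lemma ucop_star_rec : (forall x, linear (n x)) ->
  (forall x A, ucop (n x A) = tder (n x) (ucop A)) ->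
  forall A B, ucop (m A B) = tprod m m (ucop A) (ucop B).
Proof.
move=> nL ucop_n A B; have cL := @ucop_linear _ _ br.
have pL t : linear (fun s => tprod m m s t) by lin.
elim/star_ind: A => [|k u v Hu Hv|x u Hu].
- rewrite m1 ucop_one; move: (ucop B); apply: tensor_ext; [lin|lin|move=> a b].
  by rewrite tprod_pure // !m1.
- by rewrite mb.1 !cL pL Hu Hv.
rewrite mS ucop_n Hu ucop_star_prim; have nxL := nL x; have SL := Sb.2 #x.
move: (ucop u); apply: tensor_ext; [lin|lin|move=> a b].
move: (ucop B); apply: tensor_ext; [lin|lin|move=> c d].
by rewrite tder_pure // (linearD_eq (pL _)) !tprod_pure // tder_pure // !mS.
Qed.

Lemma ueps_star_rec : (forall x A, ueps (n x A) = 0) ->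
  forall A B, ueps (m A B) = ueps A * ueps B.
Proof.
move=> eps_n A B; elim/star_ind: A => [|k u v Hu Hv|x u Hu].
- by rewrite m1 ueps1 mul1r.
- by rewrite mb.1 !uepsD !uepsZ Hu Hv mulrDl mulrA.
- by rewrite mS eps_n ueps_star_prim mul0r.
Qed.
End StarRecursion.

Lemma ucop_go A B : ucop (T A B) = tprod T T (ucop A) (ucop B).
Proof.
exact: ucop_star_rec Tb (go_1l Tgo) go_star_primE (fun x => Tb.2 #x) ucop_go_prim A B.
Qed.

Lemma ueps_go A B : ueps (T A B) = ueps A * ueps B.
Proof. exact: ueps_star_rec Tb (go_1l Tgo) go_star_primE ueps_go_prim A B. Qed.

Lemma ucop_star A B : ucop (star A B) = tprod star star (ucop A) (ucop B).
Proof.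
exact: ucop_star_rec Sb star1l star_primA (fun x => Sb.2 #x) ucop_star_prim A B.
Qed.

Lemma ueps_star A B : ueps (star A B) = ueps A * ueps B.
Proof. exact: ueps_star_rec Sb star1l star_primA ueps_star_prim A B. Qed.

End Star.

(** * Gradings *)

Section Graded.
Variables (K : fieldType) (V : lmodType K) (br : V -> V -> V) (G : nat -> set V).
Hypothesis Ggr : is_grading G.
Local Notation U := (uea br).
Local Notation "# x" := (uin br x) (at level 1, format "# x").
Local Notation gr := (uea_gr br G).

Lemma ueps_gr n u : gr n u -> (0 < n)%N -> ueps u = 0.
Proof.
elim=> {n u} [n|n u v _ Hu _ Hv|n a u _ Hu||n x _|m n u v _ Hu _ Hv] //.
- by rewrite ueps0.
- by move=> n0; rewrite uepsD Hu // Hv // addr0.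
- by move=> n0; rewrite uepsZ Hu // mulr0.
- by rewrite ueps_uin.
- by rewrite addn_gt0 uepsM => /orP[/Hu|/Hv] ->; rewrite ?mul0r ?mulr0.
Qed.

Lemma tlift_gr (b : U -> U -> U) i n t : bilin b -> tens_gr G i t ->
  (forall j k u v, gr j u -> gr k v -> gr (j + k + n) (b u v)) -> gr (i + n) (tlift b t).
Proof.
move=> bP Ht Hb; elim: Ht => {i t} [i|i s t _ Hs _ Ht|i a t _ Ht|j k u v Hu Hv].
- by rewrite (tlift0 bP); apply: ugr0.
- by rewrite (tliftD bP); apply: ugrD.
- by rewrite (tliftZ bP); apply: ugrZ.
- by rewrite (tlift_pure bP); apply: Hb.
Qed.

(** Every element is a sum of homogeneous ones. P is generalised so that a scalar or a homogeneous
    left letter can be absorbed into it. *)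
Lemma uea_gr_ind (P : U -> Prop) : P 0 -> (forall u v, P u -> P v -> P (u + v)) ->
  (forall n u, gr n u -> P u) -> forall u, P u.
Proof.
move=> P0 PD Pgr u; elim/uea_mull_ind: u P P0 PD Pgr
    => [||u v Hu Hv|a u Hu|x u Hu] P P0 PD Pgr.
- by [].
- exact/Pgr/ugr1.
- exact: PD (Hu P P0 PD Pgr) (Hv P P0 PD Pgr).
- apply: (Hu (fun v => P (a *: v))) => [|v w Hv Hw|n v Hv].
  + by rewrite scaler0.
  + by rewrite scalerDr; apply: PD.
  + exact/Pgr/ugrZ/Hv.
have [_ /(_ x)[N [w [Gw ->]]] _] := Ggr.
rewrite (linear_sum_eq _ _ (@linear_uin _ _ br)) mulr_suml; apply: big_ind => // i _.
apply: (Hu (fun v => P (#(w i) * v))) => [|v v' Hv Hv'|n v Hv].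
- by rewrite mulr0.
- by rewrite mulrDr; apply: PD.
- by apply/Pgr/ugrM; [apply: ugr_in|exact: Hv].
Qed.

Hypotheses (G0 : G 0%N = [set 0]%classic) (Gfin : forall n, finite_dim (G n)).

(** Letters have positive degree, so removing the first letter of a nonzero word lowers the degree;
    strong induction on n applies. *)
Lemma uea_gr_fin n : exists s : seq U, forall u, gr n u -> lspan s u.
Proof.
suff [s Hs] : exists s : seq U, forall k u, uwords G k n u -> lspan s u.
  by exists s => u /uea_gr_uwords[k]; apply: Hs.
have /boolp.choice[e He] m : exists s : seq U, forall x, G m x -> lspan s #x.
  have [d [e [_ He]]] := Gfin m; exists [seq #(e i) | i <- enum 'I_d] => x /He[c ->].
  rewrite (linear_sum_eq _ _ (@linear_uin _ _ br)).
  apply: big_ind => [||i _]; [exact: lspan0|exact: lspanD|].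
  by rewrite uinZ; apply/lspanZ/lspan_mem/map_f; rewrite mem_enum.
elim/ltn_ind: n => n IH.
(* For [n' >= n] the list is arbitrary. The index m = 0 below does use [s n], but extra vectors in a
   spanning list do no harm. *)
have /boolp.choice[s Hs] n' : exists s : seq U,
    (n' < n)%N -> forall k u, uwords G k n' u -> lspan s u.
  by have [/IH[s Hs]|_] := ltnP n' n; [exists s|exists [::]].
exists (1 :: flatten [seq [seq a * u | a <- e m, u <- s (n - m)%N] | m <- iota 0 n.+1]).
move=> k u; move E: n => n0 H.
elim: H E => {k n0 u} [k ?|k ? u v _ Hu _ Hv|k ? a u _ Hu|k|k m n' x u Gx Hu _] nE.
- exact: lspan0.
- by apply: lspanD; [apply: Hu|apply: Hv].
- exact/lspanZ/Hu.
- by apply: lspan_mem; rewrite mem_head.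
have [m0|m_gt0] := posnP m.
  move: Gx; rewrite m0 G0 => ->; rewrite -(scale0r (0 : V)) uinZ scale0r mul0r.
  exact: lspan0.
have n'n : (n' < n)%N by rewrite nE -{1}[n']add0n ltn_add2r.
apply: (@lspan_sub _ _ [seq a * u | a <- e m, u <- s n']) => [v Hv|].
  rewrite inE; apply/orP; right; apply/flattenP.
  exists [seq a * u | a <- e m, u <- s n'] => //.
  apply/mapP; exists m; first by rewrite mem_iota /= ltnS leq_addr.
  by rewrite addKn.
elim: (He m x Gx) => [|a b _ Ha _ Hb|c a _ Ha|a ae].
- by rewrite mul0r; apply: lspan0.
- by rewrite mulrDl; apply: lspanD.
- by rewrite -scalerAl; apply: lspanZ.
elim: (Hs n' n'n _ _ Hu) => [|b c _ Hb _ Hc|c b _ Hb|b be].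
- by rewrite mulr0; apply: lspan0.
- by rewrite mulrDr; apply: lspanD.
- by rewrite -scalerAr; apply: lspanZ.
- exact/lspan_mem/allpairs_f.
Qed.

End Graded.

(** * Homogeneity of ▷ and ∗ *)

Section GradedGuinOudom.
Variables (K : fieldType) (V : lmodType K) (br tri : {bilinear V -> V -> V}).
Local Notation U := (uea br).
Local Notation "# x" := (uin br x) (at level 1, format "# x").
Variables (G : nat -> set V) (T : U -> U -> U).
Hypotheses (Tb : bilin T) (Tgo : guin_oudom tri T).
Hypotheses (Ggr : is_grading G) (Gtri : homogeneous0 G tri).
Local Notation gr := (uea_gr br G).

(** Uses (xu) ▷ y = x ▷ (u ▷ y) - (x ▷ u) ▷ y. Since x ▷ u is not a subword but only no longer than
    u, the induction is on length. *)
Lemma go_letter k n u j y : uwords G k n u -> G j y ->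
  exists2 z, G (n + j)%N z & T u #y = #z.
Proof.
have [GL _ _] := Ggr; have TL := Tb.1 #y; have uL := @linear_uin _ _ br.
elim/ltn_ind: k n u j y TL => k IH n u j y TL H Gy.
elim: H IH => {k n u} [k n|k n u v _ Hu _ Hv|k n a u _ Hu|k|k m n x u Gx Gu _] IH.
- by exists 0; [exact: (GL _).1|rewrite (linear0_eq TL) (linear0_eq uL)].
- have [z Gz uz] := Hu IH; have [t Gt vt] := Hv IH.
  exists (z + t); first by rewrite -[z]scale1r; apply: (GL _).2.
  by rewrite (linearD_eq TL) (linearD_eq uL) uz vt.
- have [z Gz uz] := Hu IH; exists (a *: z).
    by rewrite -[_ *: _]addr0; apply: (GL _).2 => //; exact: (GL _).1.
  by rewrite (linearZ_eq TL) (linearZ_eq uL) uz.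
- by exists y; rewrite ?add0n ?(go_1l Tgo).
have [z Gz uz] := IH k (ltnSn k) n u j y TL Gu Gy.
have [t Gt vt] := IH k (ltnSn k) _ _ j y TL (uwords_prim Tb Tgo Gtri Gx Gu) Gy.
exists (tri x z - t).
  rewrite addrC -scaleN1r; apply: (GL _).2 => //.
  by rewrite -addnA; apply: Gtri.
by rewrite (go_mull Tgo) uz (go_ext Tgo) vt (linearD_eq uL) (linearN_eq uL).
Qed.

Lemma go_gr i j A B : gr i A -> gr j B -> gr (i + j) (T A B).
Proof.
move=> HA HB; have TL := Tb.2.
elim: HB i A HA => {j B} [j|j B C _ HB _ HC|j a B _ HB||j y Gy|m n B C _ HB _ HC] i A HA.
- by rewrite (linear0_eq (TL _)); apply: ugr0.
- by rewrite (linearD_eq (TL _)); apply: ugrD; [apply: HB|apply: HC].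
- by rewrite (linearZ_eq (TL _)); apply/ugrZ/HB.
- rewrite (go_1r Tgo) addn0; have [i0|i_gt0] := posnP i.
    by rewrite i0; apply/ugrZ/ugr1.
  by rewrite (ueps_gr HA) // scale0r; apply: ugr0.
- have [k Hk] := uea_gr_uwords HA.
  by have [z Gz ->] := go_letter Hk Gy; apply: ugr_in.
rewrite (go_mulr Tgo); apply: tlift_gr (ucop_gr HA) _; first by lin.
by move=> k l u v Hu Hv; rewrite addnACA; apply: ugrM; [apply: HB|apply: HC].
Qed.

Lemma go_star_gr i j A B : gr i A -> gr j B -> gr (i + j) (go_star T A B).
Proof.
move=> HA HB; apply: tlift_gr (ucop_gr HA) _; first by lin.
by move=> k l u v Hu Hv; rewrite -addnA; apply/ugrM/go_gr.
Qed.

End GradedGuinOudom.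

(** * Graded duals *)

Section Pairing.
Variables (K : fieldType) (U : lmodType K) (G : nat -> set U).
Local Notation D := (gdual G).

Lemma gdual_ext (f g : D) : (forall u, f u = g u) -> f = g.
Proof. by move=> fg; apply/val_inj/funext. Qed.

Definition pair3 (A B C : U) : D ⊗ (D ⊗ D) -> K^o :=
  tlift (fun (x : D) (s : D ⊗ D) => x A * pair2 B C s : K^o).

Lemma pair2_linear A B : linear (pair2 A B : D ⊗ D -> K^o).
Proof. by rewrite /pair2; lin. Qed.

Lemma pair3_pure A B C (x : D) s : pair3 A B C (x ⊗ s) = x A * pair2 B C s.
Proof. by have pL := pair2_linear B C; rewrite /pair3 tlift_pure //; lin. Qed.

Lemma pair3_linear A B C : linear (pair3 A B C).
Proof. by have pL := pair2_linear B C; rewrite /pair3; lin. Qed.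

(** Evaluations at elements of [U] separate linear forms, so [tensor_sep] applies. *)
Lemma pair2_sep (t : D ⊗ D) : (forall A B, pair2 A B t = 0) -> t = 0.
Proof.
by apply: (tensor_sep (phi := fun A (x : D) => x A) (psi := fun A (x : D) => x A));
  [move=> A; lin|move=> A; lin|move=> x Hx; exact: gdual_ext..].
Qed.

Lemma pair2_inj (s t : D ⊗ D) : (forall A B, pair2 A B s = pair2 A B t) -> s = t.
Proof.
move=> st; apply/eqP; rewrite -subr_eq0; apply/eqP/pair2_sep => A B.
by rewrite addrC -scaleN1r (pair2_linear A B) st scaleN1r addNr.
Qed.

Lemma pair3_inj (s t : D ⊗ (D ⊗ D)) :
  (forall A B C, pair3 A B C s = pair3 A B C t) -> s = t.
Proof.
move=> st; apply/eqP; rewrite -subr_eq0; apply/eqP.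
apply: (tensor_sep (phi := fun A (x : D) => x A)
  (psi := fun (A : U * U) (x : D ⊗ D) => pair2 A.1 A.2 x)).
- by move=> A; lin.
- by move=> A; exact: pair2_linear.
- by move=> x Hx; exact: gdual_ext.
- by move=> r Hr; apply: pair2_sep => A B; exact: (Hr (A, B)).
- move=> A [B C]; rewrite -[LHS]/(pair3 A B C _).
  by rewrite addrC -scaleN1r (pair3_linear A B C) st scaleN1r addNr.
Qed.

Lemma tlift_eval_l A t u : (tlift (fun a b : D => (a A : K) *: b) t) u = pair2 A u t.
Proof.
pose b (a b : D) := (a A : K) *: b; have bP : bilin b by rewrite /b; lin.
move: t; apply: (tensor_ext (Z := K^o) (f := fun t => tlift b t u)).
- by lin.
- exact: pair2_linear.
- by move=> x y; rewrite (tlift_pure bP) pair2_pure.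
Qed.

Lemma tlift_eval_r A t u : (tlift (fun a b : D => (b A : K) *: a) t) u = pair2 u A t.
Proof.
pose b (a b : D) := (b A : K) *: a; have bP : bilin b by rewrite /b; lin.
move: t; apply: (tensor_ext (Z := K^o) (f := fun t => tlift b t u)).
- by lin.
- exact: pair2_linear.
- by move=> x y; rewrite (tlift_pure bP) pair2_pure mulrC.
Qed.

Lemma is_dual_linear (m : U -> U -> U) (d : D -> D ⊗ D) : is_dual m d -> linear d.
Proof.
move=> dE a x y; apply: pair2_inj => A B.
by rewrite (pair2_linear A B) -!dE.
Qed.

(** Together with [pair3_id], reduces coassociativity and the coaction law to associativity and the
    action law. *)
Lemma pair3_assoc (m : U -> U -> U) (d : D -> D ⊗ D) A B C t : is_dual m d ->
  pair3 A B C (tassoc (tmap d id t)) = pair2 (m A B) C t.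
Proof.
move=> dE; have dL := is_dual_linear dE.
have p3L := pair3_linear; have p2L := pair2_linear.
move: t.
apply: (tensor_ext (f := fun t => pair3 A B C (tassoc (tmap d id t)))) => [||x y].
- by apply: linear_comp; [exact: p3L|lin].
- exact: p2L.
rewrite tmap_pure // pair2_pure dE.
move: (d x); apply: (tensor_ext (f := fun s => pair3 A B C (tassoc (s ⊗ y)))
  (g := fun s => pair2 A B s * y C : K^o)) => [||f g].
- by apply: linear_comp; [exact: p3L|lin].
- by have pL := p2L A B; lin.
- by rewrite tassoc_pure pair3_pure !pair2_pure mulrA.
Qed.

Lemma pair3_id (m : U -> U -> U) (d : D -> D ⊗ D) A B C t : is_dual m d ->
  pair3 A B C (tmap id d t) = pair2 A (m B C) t.
Proof.
move=> dE; have dL := is_dual_linear dE.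
move: t; apply: (tensor_ext (f := fun t => pair3 A B C (tmap id d t))) => [||x y].
- by apply: linear_comp; [exact: pair3_linear|lin].
- exact: pair2_linear.
- by rewrite tmap_pure // pair3_pure pair2_pure dE.
Qed.

End Pairing.

(** * Transposes of products, and the shuffle algebra *)

Section Duals.
Variables (K : fieldType) (V : lmodType K) (br : V -> V -> V) (G : nat -> set V).
Local Notation U := (uea br).
Local Notation gr := (uea_gr br G).
Local Notation D := (gdual gr).
Local Notation ucop := (@ucop K V br).
Hypotheses (Ggr : is_grading G) (G0 : G 0%N = [set 0]%classic).
Hypothesis Gfin : forall n, finite_dim (G n).

Section Existence.
Variable m : U -> U -> U.
Hypothesis mb : bilin m.
Hypothesis mgr : forall i j u v, gr i u -> gr j v -> gr (i + j) (m u v).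

Lemma slice_subproof (x : D) A : (fun B => x (m A B)) \in gdual_pred gr.
Proof.
apply/asboolP; split; first by lin.
have /asboolP[xL [N xN]] := gdualP x.
elim/(@uea_gr_ind _ _ br _ Ggr): A => [|A A' [M HM] [M' HM']|i A HA].
- by exists 0%N => n u _ _; rewrite (linear0_eq (mb.1 u)) (linear0_eq xL).
- exists (maxn M M') => n u; rewrite geq_max => /andP[Mn M'n] Gu.
  by rewrite (linearD_eq (mb.1 u)) (linearD_eq xL) (HM n) // (HM' n) // addr0.
- exists N => n u Nn Gu; apply: (xN (i + n)%N); last exact: mgr.
  exact: leq_trans Nn (leq_addl _ _).
Qed.
Definition slice (x : D) A : D := GDual (slice_subproof x A).

Lemma slice_linear x : linear (slice x).
Proof.
by move=> a A A'; apply: gdual_ext => B; rewrite /= mb.1 (linear_gval x).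
Qed.

(* The bilinear form x (m A B) has finite rank, since it vanishes as soon as  *)
(* A has large degree. *)
Lemma is_dual_ex (x : D) : exists t : D ⊗ D, forall A B, x (m A B) = pair2 A B t.
Proof.
have /asboolP[xL [N xN]] := gdualP x; have sL := slice_linear x.
have slice0 n A : (N <= n)%N -> gr n A -> slice x A = 0.
  move=> Nn HA; apply: gdual_ext => B /=.
  elim/(@uea_gr_ind _ _ br _ Ggr): B => [|B B' HB HB'|j B HB].
  - by rewrite (linear0_eq (mb.2 A)) (linear0_eq xL).
  - by rewrite (linearD_eq (mb.2 A)) (linearD_eq xL) HB HB' addr0.
  - by apply: (xN (n + j)%N); [exact: leq_trans Nn (leq_addr _ _)|exact: mgr].
have /boolp.choice[s Hs] := uea_gr_fin br G0 Gfin.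
(* Slices vanish in degrees at least N, so those of the spanning lists in degrees below N span the
   image. *)
pose S := flatten [seq map (slice x) (s n) | n <- iota 0 N].
have [||r [w [c [cL c0 cE]]]] := @finite_rank K U D (slice x) (size S) (fun k => S`_k).
- exact: sL.
- move=> A; apply: lspan_coord.
  elim/(@uea_gr_ind _ _ br _ Ggr): A => [|A A' HA HA'|n A HA].
  + by rewrite (linear0_eq sL); apply: lspan0.
  + by rewrite (linearD_eq sL); apply: lspanD.
  have [Nn|nN] := leqP N n; first by rewrite (slice0 n) //; apply: lspan0.
  apply: (@lspan_sub _ _ (map (slice x) (s n))); last exact/lspan_map/Hs.
  move=> f Hf; apply/flattenP; exists (map (slice x) (s n)) => //.
  by apply/mapP; exists n; rewrite ?mem_iota.
(* A coordinate vanishes wherever the slice does, hence in all degrees at least N. *)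
have cD k : c k \in gdual_pred gr.
  by apply/asboolP; split=> //; exists N => n A Nn HA; apply: c0; apply: slice0 HA.
exists (\sum_k GDual (cD k) ⊗ w k) => A B.
rewrite (linear_sum_eq _ _ (pair2_linear A B)) -[LHS]/(slice x A B) cE.
rewrite (linear_sum_eq (f := fun y : D => y B : K^o)); last by lin.
by apply: eq_bigr => k _; rewrite pair2_pure.
Qed.

Lemma dual_copP : is_dual m (dual_cop (G := gr) m).
Proof. by move=> x; apply: (xgetPex 0 (is_dual_ex x)). Qed.

End Existence.

Local Notation shuffle := (@shuffle K V br G).
Local Notation gone := (gone br G).

Lemma shuffleE f g u : shuffle f g u = tlift (fun a b => f a * g b : K^o) (ucop u).
Proof. by []. Qed.

Lemma shuffle_bilin : bilin shuffle.
Proof.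
split=> h a f g; apply: gdual_ext => u.
  have L : linear (fun f : D => tlift (fun a b => f a * h b : K^o) (ucop u)) by lin.
  exact: (L a f g).
have L : linear (fun f : D => tlift (fun a b => h a * f b : K^o) (ucop u)) by lin.
exact: (L a f g).
Qed.

(** Both sides evaluate f ⊗ g ⊗ h (the form [F3]) on an iterated coproduct of u; [ucopA] identifies
    the two. *)
Lemma shuffleA : associative shuffle.
Proof.
move=> f g h; apply: gdual_ext => u; rewrite !shuffleE.
pose F (s : U ⊗ U) := tlift (fun a b => g a * h b : K^o) s.
have FL : linear F by rewrite /F; lin.
pose F3 := tlift (fun (a : U) s => f a * F s : K^o).
have F3L : linear F3 by rewrite /F3; lin.
have F3p a s : F3 (a ⊗ s) = f a * F s by rewrite /F3 tlift_pure //; lin.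
have cL := @ucop_linear _ _ br.
transitivity (F3 (tmap id ucop (ucop u))).
  move: (ucop u); apply: tensor_ext => [||a b]; [|lin|].
    by have := linear_gval (shuffle g h); lin.
  by rewrite tlift_pure ?tmap_pure ?F3p //; lin.
rewrite -ucopA; move: (ucop u); apply: tensor_ext => [||a b]; [lin| |].
  by have := linear_gval (shuffle f g); lin.
rewrite tlift_pure ?tmap_pure // ?shuffleE; [|lin..].
move: (ucop a); apply: (tensor_ext (f := fun s => F3 (tassoc (s ⊗ b)))
  (g := fun s => tlift (fun a b => f a * g b : K^o) s * h b : K^o)); [lin|lin|].
move=> c d; rewrite tassoc_pure F3p /F !tlift_pure ?mulrA //; lin.
Qed.

Lemma shuffle1l f : shuffle gone f = f.
Proof.
have fL := linear_gval f; apply: gdual_ext => u.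
rewrite -{2}(ucop_counitl u) shuffleE; move: (ucop u).
apply: tensor_ext => [||a b]; [lin|lin|].
by rewrite !tlift_pure ?(linearZ_eq fL) //; lin.
Qed.

Lemma shuffle1r f : shuffle f gone = f.
Proof.
have fL := linear_gval f; apply: gdual_ext => u.
rewrite -{2}(ucop_counitr u) shuffleE; move: (ucop u).
apply: tensor_ext => [||a b]; [lin|lin|].
by rewrite !tlift_pure ?(linearZ_eq fL) 1?mulrC //; lin.
Qed.

Section Dual.
Variables (m : U -> U -> U) (d : D -> D ⊗ D).
Hypotheses (mb : bilin m) (dE : is_dual m d).

Lemma is_dual_one : (forall A B, ueps (m A B) = ueps A * ueps B) ->
  d gone = gone ⊗ gone.
Proof. by move=> em; apply: pair2_inj => A B; rewrite -dE pair2_pure -em. Qed.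

Lemma is_dual_mul : (forall A B, ucop (m A B) = tprod m m (ucop A) (ucop B)) ->
  forall x y, d (shuffle x y) = tprod shuffle shuffle (d x) (d y).
Proof.
move=> cm x y; apply: pair2_inj => A B; rewrite -dE shuffleE cm.
(* [W] at the coproducts of A and B is the sum of ⟨A1 ⊗ B1, s⟩⟨A2 ⊗ B2, t⟩, the common value of both
   sides. *)
pose W (s t : D ⊗ D) P Q : K^o := tlift (fun a a' => tlift (fun b b' =>
  pair2 a b s * pair2 a' b' t : K^o) Q) P.
transitivity (W (d x) (d y) (ucop A) (ucop B)).
  rewrite /W; move: (ucop A); apply: (tensor_ext (Z := K^o)) => [||a a']; [lin|lin|].
  move: (ucop B); apply: (tensor_ext (Z := K^o)) => [||b b']; [lin|lin|].
  by rewrite tprod_pure // !tlift_pure -?dE //; lin.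
have shP := shuffle_bilin.
move: (d x) (d y) => s t; move: s; apply: (tensor_ext (Z := K^o) (f := fun s => W s t _ _)
  (g := fun s => pair2 A B (tprod shuffle shuffle s t))) => [||f g].
- by rewrite /W; lin.
- by apply: linear_comp; [exact: pair2_linear|lin].
move: t; apply: (tensor_ext (Z := K^o) (f := fun t => W (f ⊗ g) t _ _)
  (g := fun t => pair2 A B (tprod shuffle shuffle (f ⊗ g) t))) => [||f' g'].
- by rewrite /W; lin.
- by apply: linear_comp; [exact: pair2_linear|lin].
rewrite tprod_pure // pair2_pure !shuffleE /W.
move: (ucop A); apply: (tensor_ext (Z := K^o)) => [||a a']; [lin|lin|].
move: (ucop B); apply: (tensor_ext (Z := K^o)) => [||b b']; [lin|lin|].
by rewrite !tlift_pure ?pair2_pure; [exact: mulrACA|lin..].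
Qed.

End Dual.
End Duals.

(** * The dual bialgebras and their cointeraction *)

Section Bialgebra.
Variables (K : fieldType) (V : lmodType K) (br : {bilinear V -> V -> V}).
Variable G : nat -> set V.
Local Notation U := (uea br).
Local Notation gr := (uea_gr br G).
Local Notation D := (gdual gr).
Local Notation ucop := (@ucop K V br).
Hypotheses (Ggr : is_grading G) (G0 : G 0%N = [set 0]%classic).
Hypothesis Gfin : forall n, finite_dim (G n).

Lemma dual_bialgP (m : U -> U -> U) : bilin m ->
  (forall i j u v, gr i u -> gr j v -> gr (i + j) (m u v)) ->
  associative m -> left_id 1 m -> right_id 1 m ->
  (forall A B, ucop (m A B) = tprod m m (ucop A) (ucop B)) ->
  (forall A B, ueps (m A B) = ueps A * ueps B) ->
  is_bialgebra (dual_bialg G m).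
Proof.
move=> mb mgr mA m1l m1r cm em.
have dE := dual_copP Ggr G0 Gfin mb mgr.
split=> /=.
- exact: shuffle_bilin.
- exact: shuffleA.
- exact: shuffle1l.
- exact: shuffle1r.
- exact: is_dual_linear dE.
- move=> x; apply: pair3_inj => A B C.
  by rewrite (pair3_assoc _ _ _ _ dE) (pair3_id _ _ _ _ dE) -!dE mA.
- by [].
- by move=> x; apply: gdual_ext => u; rewrite tlift_eval_l -dE m1l.
- by move=> x; apply: gdual_ext => u; rewrite tlift_eval_r -dE m1r.
- exact: is_dual_one dE em.
- exact: is_dual_mul mb dE cm.
- exact: ueps1.
- by move=> x y; rewrite /shuffle_fun ucop_one tlift_pure //; lin.
Qed.

Lemma HTdual_bialgP : is_bialgebra (HTdual br G).
Proof.
apply: dual_bialgP.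
- exact: bilin_mul.
- exact: ugrM.
- exact: mulrA.
- exact: mul1r.
- exact: mulr1.
- move=> A B; rewrite ucopM; exact: erefl.
- exact: uepsM.
Qed.

Variables (tri : {bilinear V -> V -> V}) (T : U -> U -> U).
Hypotheses (Tb : bilin T) (Tgo : guin_oudom tri T) (Gtri : homogeneous0 G tri).

Lemma Hdual_bialgP : is_bialgebra (Hdual G T).
Proof.
apply: dual_bialgP.
- exact: go_star_bilin.
- exact: go_star_gr Tb Tgo Ggr Gtri.
- exact: starA Tb Tgo.
- exact: star1l Tb Tgo.
- exact: star1r Tb Tgo.
- exact: ucop_star Tb Tgo.
- exact: ueps_star Tb Tgo.
Qed.

Variable rho : D -> D ⊗ D.
Hypothesis rhoE : is_dual T rho.

(** Transposed, the right side of the comultiplication axiom is the sum of x((A1 ▷ B)(A2 ▷ C)),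
    which [go_mulr] collapses. *)
Lemma pair3_m13 A B C (x : D) :
  pair3 A B C (m13 (A := HTdual br G) (B := Hdual G T)
    (tmap rho rho (dual_cop *%R x : D ⊗ D))) = x (T A (B * C)).
Proof.
have dE := dual_copP Ggr G0 Gfin (bilin_mul U) (@ugrM _ _ br G).
have xL := linear_gval x; have rL := is_dual_linear rhoE.
have shP := @shuffle_bilin _ _ br G.
rewrite (go_mulr Tgo).
transitivity (tlift (fun a a' => x (T a B * T a' C) : K^o) (ucop A)); last first.
  by move: (ucop A); apply: (tensor_ext (Z := K^o)) => [||a a']; [lin|lin|];
     rewrite !tlift_pure //; lin.
(* [M] is [m13] with the bialgebra projections computed away. *)
pose M : (D ⊗ D) ⊗ (D ⊗ D) -> D ⊗ (D ⊗ D) := tlift (fun s t =>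
  tlift (fun a b => tlift (fun c d => shuffle a c ⊗ (b ⊗ d)) t) s).
have ML : linear M by rewrite /M; lin.
have M_pure s t : pair3 A B C (M (s ⊗ t)) =
    tlift (fun a a' => pair2 a B s * pair2 a' C t : K^o) (ucop A).
  move: s; apply: (tensor_ext (Z := K^o) (f := fun s => pair3 A B C (M (s ⊗ t))))
    => [||a b]; [by apply: linear_comp; [exact: pair3_linear|lin]|lin|].
  move: t; apply: (tensor_ext (Z := K^o)
      (f := fun t => pair3 A B C (M ((a ⊗ b) ⊗ t))))
    => [||c d]; [by apply: linear_comp; [exact: pair3_linear|lin]|lin|].
  rewrite /M !tlift_pure; [|lin..].
  rewrite pair3_pure pair2_pure shuffleE.
  move: (ucop A); apply: (tensor_ext (Z := K^o)) => [||u v]; [lin|lin|].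
  by rewrite !tlift_pure ?pair2_pure; [exact: mulrACA|lin..].
transitivity (tlift (fun a a' => pair2 (T a B) (T a' C) (dual_cop *%R x) : K^o) (ucop A)).
  rewrite -[LHS]/(pair3 A B C (M (tmap rho rho (dual_cop *%R x)))).
  move: (dual_cop *%R x); apply: (tensor_ext (Z := K^o)
    (f := fun r => pair3 A B C (M (tmap rho rho r)))) => [||f g].
  - by apply: linear_comp; [exact: pair3_linear|lin].
  - by lin.
  rewrite tmap_pure // M_pure; move: (ucop A).
  apply: (tensor_ext (Z := K^o)) => [||u v]; [lin|lin|].
  by rewrite !tlift_pure ?pair2_pure -?rhoE //; lin.
move: (ucop A); apply: (tensor_ext (Z := K^o)) => [||u v]; [lin|lin|].
by rewrite !tlift_pure -?dE //; lin.
Qed.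

Lemma coaction_go : is_coaction (HTdual br G) (Hdual G T) rho.
Proof.
have sE := dual_copP Ggr G0 Gfin (go_star_bilin Tb) (go_star_gr Tb Tgo Ggr Gtri).
split=> /= [|x|x].
- exact: is_dual_linear rhoE.
- apply: pair3_inj => A B C.
  by rewrite (pair3_assoc _ _ _ _ sE) (pair3_id _ _ _ _ rhoE) -!rhoE (go_action Tb Tgo).
- by apply: gdual_ext => u; rewrite tlift_eval_l -rhoE (go_1l Tgo).
Qed.

Lemma cointeraction_go : cointeraction (HTdual br G) (Hdual G T) rho.
Proof.
have dE := dual_copP Ggr G0 Gfin (bilin_mul U) (@ugrM _ _ br G).
split=> /=.
- exact: HTdual_bialgP.
- exact: Hdual_bialgP.
- exact: coaction_go.
- exact: is_dual_one rhoE (ueps_go Tb Tgo).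
- exact: is_dual_mul Tb rhoE (ucop_go Tb Tgo).
- move=> x; apply: gdual_ext => u.
  rewrite tlift_eval_r -rhoE (go_1r Tgo) (linearZ_eq (linear_gval x)); exact: mulrC.
- move=> x; apply: pair3_inj => A B C.
  by rewrite (pair3_id _ _ _ _ dE) -rhoE -pair3_m13.
Qed.

End Bialgebra.

Theorem theorem2p6 (K : fieldType) (charK : [pchar K] =i pred0)
  (V : lmodType K) (br tri : {bilinear V -> V -> V})
  (Vpl : is_post_lie br tri)
  (G : nat -> set V) (Ggr : is_grading G) (G0 : G 0%N = [set 0]%classic)
  (Gfin : forall n, finite_dim (G n))
  (Gbr : homogeneous0 G br) (Gtri : homogeneous0 G tri)
  (T : {bilinear uea br -> uea br -> uea br}) (Tgo : guin_oudom tri T) :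
  (exists rho : {linear HTdual br G -> (Hdual G T ⊗ HTdual br G)%type},
     is_dual T rho) /\
  (forall rho : {linear HTdual br G -> (Hdual G T ⊗ HTdual br G)%type},
     is_dual T rho ->
     is_coaction (HTdual br G) (Hdual G T) rho /\
     cointeraction (HTdual br G) (Hdual G T) rho).
Proof.
have Tb : bilin T by split=> A; [apply: linearPl|apply: linearPr].
split=> [|rho rhoE].
  have TE := dual_copP Ggr G0 Gfin Tb (go_gr Tb Tgo Ggr Gtri).
  (* A transpose is linear because the pairing is injective; this equips [dual_cop T] with the
     required structure. *)
  pose rhoL := GRing.isLinear.Build _ _ _ _ _ (is_dual_linear TE).
  pose rho : {linear HTdual br G -> (Hdual G T ⊗ HTdual br G)%type} :=
    HB.pack_for {linear HTdual br G -> (Hdual G T ⊗ HTdual br G)%type}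
      (dual_cop (G := uea_gr br G) T) rhoL.
  by exists rho.
split; first exact: (coaction_go Ggr G0 Gfin Tb Tgo Gtri rhoE).
exact: (cointeraction_go Ggr G0 Gfin Tb Tgo Gtri rhoE).
Qed.
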